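(* Let $I$ be a countable index set and, for each $k\ge1$, let $\mathbf X^k=(X^k_i)_{i\in I}$ be a family of random elements of a POP space $(\mathbb X,\preceq)$. Suppose that either every $\mathbf X^k$ is negatively associated or every $\mathbf X^k$ is positively associated, and that $\mathbf X^k\to\mathbf X=(X_i)_{i\in I}$ in distribution as random elements of $\mathbb X^I$ (product topology) as $k\to\infty$. Then $\mathbf X$ is negatively associated in the first case and positively associated in the second case.
   Context: A POP space is a Polish space $\mathbb X$ with a closed partial order $\preceq$ (the set $\{(x,x'):x\preceq x'\}$ is closed in $\mathbb X^2$). For $J\subset I$, $X_J=(X_i)_{i\in J}$ is a random element of $\mathbb X^J$ with product topology, product Borel $\sigma$-field and coordinatewise order; $f$ is non-decreasing if $x\preceq y$ coordinatewise implies $f(x)\le f(y)$. A family $\mathbf X=(X_i)_{i\in I}$ is negatively associated (NA) if $\mathbb E[f(X_J)g(X_{I\setminus J})]\le \mathbb E[f(X_J)]\,\mathbb E[g(X_{I\setminus J})]$ for all $J\subset I$ and all bounded measurable non-decreasing $f:\mathbb X^J\to\mathbb R$, $g:\mathbb X^{I\setminus J}\to\mathbb R$; it is positively associated (PA) if $\mathbb E[f(X_J)g(X_J)]\ge \mathbb E[f(X_J)]\,\mathbb E[g(X_J)]$ for all $J\subset I$ and all bounded measurable non-decreasing $f,g:\mathbb X^J\to\mathbb R$. *)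

(* Defs.v *)
From HB Require Import structures.
From mathcomp Require Import all_boot all_order all_algebra.
From mathcomp Require Import all_classical all_reals all_analysis.
Set Implicit Arguments. Unset Strict Implicit. Unset Printing Implicit Defensive.
Import Order.TTheory GRing.Theory Num.Theory.
Import numFieldNormedType.Exports.
Local Open Scope classical_set_scope.
Local Open Scope ring_scope.

Definition borel_sets (T : topologicalType) : set (set T) := <<s @open T >>.

Definition prod_sigma (K : Type) (T : topologicalType) : set (set (K -> T)) :=
  <<s [set A | exists k B, borel_sets B /\ A = [set x | B (x k)]] >>.

Section POP.
Variable R : realType.

(* Polish space: separable, completely metrizable.  The complete metric is
   given by the structure of [T : completePseudoMetricType R]; we add the
   Hausdorff (hence metric) and separability conditions. *)
Definition polish (T : completePseudoMetricType R) : Prop :=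
  hausdorff_space T /\ exists D : set T, countable D /\ closure D = [set: T].

Definition closed_partial_order (T : topologicalType) (le : T -> T -> Prop) :=
  [/\ (forall x, le x x),
      (forall x y, le x y -> le y x -> x = y),
      (forall x y z, le x y -> le y z -> le x z) &
      closed [set p : T * T | le p.1 p.2]].

Definition bounded_fun (U : Type) (f : U -> R) := exists M : R, forall x, `|f x| <= M.

Definition prod_measurable_fun (K : Type) (T : topologicalType) (f : (K -> T) -> R) :=
  forall B : set R, measurable B -> prod_sigma (f @^-1` B).

Definition coord_nondecreasing (K : Type) (T : Type) (le : T -> T -> Prop)
  (f : (K -> T) -> R) := forall x y : K -> T, (forall k, le (x k) (y k)) -> f x <= f y.

Definition admissible (K : Type) (T : topologicalType) (le : T -> T -> Prop)
  (f : (K -> T) -> R) :=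
  [/\ bounded_fun f, prod_measurable_fun f & coord_nondecreasing le f].

Definition restr (I : Type) (T : Type) (J : set I) (x : I -> T) : {i : I | J i} -> T :=
  fun j => x (proj1_sig j).
Arguments restr {I T} J x _.

Definition random_family (d : measure_display) (Omega : measurableType d)
  (I : Type) (T : topologicalType) (X : Omega -> I -> T) :=
  forall i (B : set T), borel_sets B -> measurable ((fun w => X w i) @^-1` B).

Local Open Scope ereal_scope.

Definition negatively_associated (d : measure_display) (Omega : measurableType d)
  (P : probability Omega R) (I : Type) (T : topologicalType) (le : T -> T -> Prop)
  (X : Omega -> I -> T) :=
  forall (J : set I) (f : ({i : I | J i} -> T) -> R) (g : ({i : I | (~` J) i} -> T) -> R),
    admissible le f -> admissible le g ->
    \int[P]_w (f (restr J (X w)) * g (restr (~` J) (X w)))%:E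
    <= (\int[P]_w (f (restr J (X w)))%:E) * (\int[P]_w (g (restr (~` J) (X w)))%:E).

Definition positively_associated (d : measure_display) (Omega : measurableType d)
  (P : probability Omega R) (I : Type) (T : topologicalType) (le : T -> T -> Prop)
  (X : Omega -> I -> T) :=
  forall (J : set I) (f g : ({i : I | J i} -> T) -> R),
    admissible le f -> admissible le g ->
    (\int[P]_w (f (restr J (X w)))%:E) * (\int[P]_w (g (restr J (X w)))%:E)
    <= \int[P]_w (f (restr J (X w)) * g (restr J (X w)))%:E.

Definition cvg_in_distribution (I : Type) (T : topologicalType)
  (d : nat -> measure_display) (Omega : forall k, measurableType (d k))
  (P : forall k, probability (Omega k) R) (Xs : forall k, Omega k -> I -> T)
  (d0 : measure_display) (Omega0 : measurableType d0) (P0 : probability Omega0 R)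
  (X : Omega0 -> I -> T) :=
  forall h : {ptws I -> T} -> R, continuous h -> bounded_fun h ->
    (fun k => \int[P k]_w (h (Xs k w))%:E) @ \oo --> \int[P0]_w (h (X w))%:E.
End POP.

(* Main.v *)
(** Weak convergence only controls integrals of continuous functions, while
    association is tested on merely measurable monotone functions.  The bridge
    is the following approximation, on a countable power Y of the space.

    The sequence is uniformly tight: some compact C carries all the laws up to
    e.  Let A be a measurable upper set.  By regularity there are a closed F and
    an open V with F <= A <= V and P(V \ F) <= e.  The up-closure of F /\ C meets
    C in a compact subset of V; let u be a Urysohn function equal to 1 there and
    to 0 off V.  The down-closure D of the compact set {u <= 1/2} /\ C is closed
    since the order is, so O = ~D is an open upper set (no normality of the order
    is required), it contains F /\ C, and u > 1/2 on O /\ C.  Let phi be a Urysohn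
    function equal to 1 on F /\ C and to 0 on D.  Then phi <= 1_O <= min(1, 2u) on
    C, and the two continuous bounds differ little in P-mean, hence in
    P_k-mean for large k.  Therefore phi is L1(P)-close to 1_A and
    L1(P_k)-close to the monotone function 1_O.

    Slicing into level sets extends this to bounded monotone f: there are phi
    continuous and f' monotone with phi close to f under P and to f' under P_k.
    Consequently the covariance of f and g under P is close to a covariance of
    monotone functions f' and g' under P_k, and inherits its sign. *)
Require Import Defs.
From HB Require Import structures.
From mathcomp Require Import all_boot all_order all_algebra.
From mathcomp Require Import all_classical all_reals all_analysis.
From mathcomp Require Import measurable_realfun ring lra.
Set Implicit Arguments. Unset Strict Implicit. Unset Printing Implicit Defensive.
Import Order.TTheory GRing.Theory Num.Theory.
Import numFieldNormedType.Exports.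
(* Imported again so that [bounded_fun] is not MathComp-Analysis's notation. *)
Import Defs.
Local Open Scope classical_set_scope.
Local Open Scope ring_scope.

(** * Separation and order in product spaces *)

Section topology.

(** Compactness yields a single entourage that keeps all of [K] away from [F]. The two sets are then
    uniformly separated, which is what the Urysohn function of a uniform space requires. *)
Lemma compact_closed_Urysohn (R : realType) (U : uniformType) (K F : set U) :
  compact K -> closed F -> K `&` F = set0 ->
  exists h : U -> R, [/\ continuous h, (forall x, 0 <= h x <= 1),
    (forall x, K x -> h x = 1) & (forall x, F x -> h x = 0)].
Proof.
move=> cK cF KF0.
(* A point of [K] makes the entourage filter proper; if [K] is empty the zero function serves. *)
have [K0|/set0P[x0 _]] := eqVneq K set0.
  exists (cst 0); split => [|x|x|//]; first exact: cst_continuous.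
    by rewrite lexx ler01.
  by rewrite K0.
have PF : ProperFilter (@entourage U).
  split; last exact: entourage_filter.
  by move=> e0; have := @entourage_refl U set0 x0 e0.
have oF : open (~` F) by exact: closed_openC.
have [E entE EK] : exists2 E : set (U * U), entourage E &
    forall x y, K x -> E (x, y) -> ~ F y.
  have /compact_near_coveringP cvK := cK.
  (* Near-covering compactness with arbitrarily small entourages as parameter: an entourage good
     near each point of [K] becomes good on the whole of [K]. *)
  have := cvK _ (powerset_filter_from (@entourage U))
    (fun E x => forall y, E (x, y) -> ~ F y) (powerset_filter_from_filter _).
  case.
    move=> x Kx.
    have nFx : ~ F x by move=> Fx; have : (K `&` F) x by []; rewrite KF0.
    have : nbhs x (~` F) by exact: open_nbhs_nbhs.
    rewrite -nbhs_entourageE => -[E entE EF].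
    pose S := split_ent E.
    have entS : entourage S by exact: entourage_split_ent.
    exists (xsection S x, [set E' | E' `<=` S]).
      split => /=; first exact: nbhs_entourage.
      exact: (small_set_sub entS).
    move=> [x' E'] /= [/xsectionP Sxx' E'S] y /E'S Sx'y.
    by apply: EF; apply/xsectionP; exact: (entourage_split x').
  move=> M [MsubE _ [E ME]] MK.
  exists E; first exact: MsubE.
  by move=> x y Kx Exy; exact: (MK _ ME x Kx y).
have sep : uniform_separator F K.
  (* The Urysohn function vanishes on its first set, so the pair is taken as [F], [K]; [E] leads
     from [K] to [F] and has to be inverted. *)
  apply: uniform_separatorW; exists (E^-1)%relation; first exact: entourage_inv.
  by rewrite -subset0 => -[y x] /= [[Fy Kx]] /(EK _ _ Kx).
exists (Urysohn F K : U -> R); split.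
- exact: Urysohn_continuous.
- move=> x; have /= := @Urysohn_range U R F K (Urysohn F K x).
  by rewrite in_itv /=; apply; exists x.
- by move=> x Kx; apply: (Urysohn_sub1 sep); exists x.
- by move=> x Fx; apply: (Urysohn_sub0 sep); exists x.
Qed.

(** If [x] lies below no point of [D], each [z] in [D] fails to dominate [x] at some coordinate. As
    the order is closed, the failure persists near [x] and near [z], and compactness of [D] gives
    one neighbourhood of [x] valid for all [z]. *)
Lemma compact_downset_closed (K : Type) (T : topologicalType)
  (le : T -> T -> Prop) (D : set {ptws K -> T}) :
  closed [set p : T * T | le p.1 p.2] -> compact D ->
  closed [set x : {ptws K -> T} |
    exists2 z : {ptws K -> T}, D z & forall k, le (x k) (z k)].
Proof.
move=> cle /compact_near_coveringP cvD.
rewrite -[X in closed X]setCK; apply: open_closedC.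
rewrite openE => x nx.
apply: filterS (cvD _ (nbhs x) (fun x' z => ~ (forall k, le (x' k) (z k))) _ _).
  by move=> x' Dx' [z Dz]; exact: Dx'.
  move=> z Dz.
  have /existsNP[k nle] : ~ forall k, le (x k) (z k).
    by move=> h; apply: nx; exists z.
  have : nbhs (x k, z k) (~` [set p : T * T | le p.1 p.2]).
    by apply: open_nbhs_nbhs; split => //; exact: closed_openC.
  move=> [[A B] /= [xA zB] AB].
  exists ((fun f : {ptws K -> T} => f k) @^-1` B,
          (fun f : {ptws K -> T} => f k) @^-1` A).
    split => /=.
    - exact: (@proj_continuous {classic K} (fun=> T) k z).
    - exact: (@proj_continuous {classic K} (fun=> T) k x).
  move=> [z' x'] /= [Bz Ax] /(_ k); exact: (AB (x' k, z' k)).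
Qed.
End topology.

(** * Measurability in countable products *)

Section measurability.

Lemma prod_sigma_coordinate (K : Type) (T : topologicalType) (k : K) (B : set T) :
  borel_sets B -> prod_sigma [set x : K -> T | B (x k)].
Proof. by move=> bB; apply: sub_sigma_algebra; exists k, B. Qed.

Lemma sigma_algebra_countable_bigcup (U : Type) (G : set (set U)) (C : countType)
    (S : set C) (F : C -> set U) :
  (forall c, S c -> <<s G >> (F c)) -> <<s G >> (\bigcup_(c in S) F c).
Proof.
move=> GF.
rewrite (_ : \bigcup_(c in S) F c = \bigcup_n
    (if unpickle n is Some c then (if c \in S then F c else set0) else set0)).
  apply: sigma_algebra_bigcup => n.
  case: unpickle => [c|]; last exact: sigma_algebra0.
  by case: ifPn => [/set_mem/GF//|_]; exact: sigma_algebra0.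
rewrite eqEsubset; split => x.
  move=> [c Sc Fcx]; exists (pickle c) => //.
  by rewrite pickleK mem_set.
move=> [n _]; case: unpickle => // c; case: ifPn => // /set_mem Sc Fcx.
by exists c.
Qed.

Lemma sigma_algebra_setC (U : Type) (G : set (set U)) (A : set U) :
  <<s G >> A -> <<s G >> (~` A).
Proof. by move=> GA; rewrite -setTD; exact: sigma_algebraCD. Qed.

Lemma sigma_algebraI (U : Type) (G : set (set U)) (A B : set U) :
  <<s G >> A -> <<s G >> B -> <<s G >> (A `&` B).
Proof.
move=> GA GB; rewrite -[A `&` B]setCK setCI -bigcup2E.
apply: sigma_algebra_setC; apply: sigma_algebra_bigcup => -[|[|n]] /=.
- exact: sigma_algebra_setC.
- exact: sigma_algebra_setC.
- exact: sigma_algebra0.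
Qed.

Lemma sigma_algebraT (U : Type) (G : set (set U)) : <<s G >> [set: U].
Proof. by have := sigma_algebra_setC (@sigma_algebra0 _ setT G); rewrite setC0. Qed.

(** A finite list of triples confines chosen coordinates to small balls around points of the dense
    set. There are countably many lists, and each point of an open set lies in such a cylinder
    contained in the set. *)
Lemma open_prod_sigma (R : realType) (K : Type) (T : completePseudoMetricType R)
    (O : set {ptws K -> T}) :
  polish T -> countable [set: K] -> open O -> prod_sigma (O : set (K -> T)).
Proof.
move=> [_ [D [/countable_injP[t tinj] clD]]] /countable_injP[j jinj] oO.
(* A code matching no coordinate or no dense point constrains nothing. *)
pose radius (m : nat) : R := m.+1%:R^-1.
pose cyl1 (c : nat * nat * nat) : set (K -> T) :=
  [set x | forall k q, j k = c.1.1 -> D q -> t q = c.1.2 ->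
     (interior (ball q (radius c.2))) (x k)].
pose cyl (l : seq (nat * nat * nat)) : set (K -> T) :=
  [set x | forall c, c \in l -> cyl1 c x].
have mcyl1 c : prod_sigma (cyl1 c).
  have [[k [q [jk Dq tq]]]|nkq] :=
      pselect (exists k q, [/\ j k = c.1.1, D q & t q = c.1.2]).
    rewrite (_ : cyl1 c = [set x | (interior (ball q (radius c.2))) (x k)]).
      apply: prod_sigma_coordinate; apply: sub_sigma_algebra.
      exact: open_interior.
    rewrite eqEsubset; split => x /=; first exact.
    move=> xk k' q' jk' Dq' tq'.
    have -> : k' = k by apply: jinj; rewrite ?inE ?jk'.
    have -> // : q' = q by apply: tinj; rewrite ?inE ?tq'.
  rewrite (_ : cyl1 c = setT); first exact: sigma_algebraT.
  rewrite -subTset => x _ k q jk Dq tq; exfalso; apply: nkq.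
  by exists k, q.
have mcyl l : prod_sigma (cyl l).
  elim: l => [|c l IH].
    rewrite (_ : cyl [::] = setT); first exact: sigma_algebraT.
    by rewrite -subTset => x _ c.
  rewrite (_ : cyl (c :: l) = cyl1 c `&` cyl l); first exact: (sigma_algebraI (mcyl1 c) IH).
  rewrite eqEsubset; split => x /=.
    move=> cx; split=> [|c' c'l]; apply: cx; rewrite inE ?eqxx//.
    by rewrite c'l orbT.
  by move=> [cx lx] c'; rewrite inE => /predU1P[->//|]; exact: lx.
rewrite (_ : O = \bigcup_(l in [set l | cyl l `<=` O]) cyl l).
  by apply: sigma_algebra_countable_bigcup => l _; exact: mcyl.
rewrite eqEsubset; split => x; last by move=> [l /= lO /lO].
move=> Ox.
(* The cylinders through [x] generate a filter, since concatenation of lists is intersection of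
   cylinders. Its convergence to [x] can be tested one coordinate at a time. *)
pose Fx := filter_from [set l | cyl l x] cyl.
have FFx : Filter Fx.
  apply: filter_from_filter; first by exists [::].
  move=> l1 l2 /= l1x l2x; exists (l1 ++ l2).
    by move=> c; rewrite mem_cat => /orP[/l1x|/l2x].
  by move=> y yl; split=> c cl; apply: yl; rewrite mem_cat cl ?orbT.
have : Fx --> (x : {ptws K -> T}).
  apply/cvg_sup => k W [_ [[V oV <-] /= Vxk] VW]; apply: filterS VW _.
  have /nbhs_ballP[e /= e0 eV] : nbhs (x k) V by exact: open_nbhs_nbhs.
  have [m me] : exists m, radius m < e / 2.
    have [m] := @ltr_add_invr R 0 (e / 2) (divr_gt0 e0 (ltr0Sn _ _)).
    by rewrite add0r => me; exists m.
  have r0 : 0 < radius m / 2 by rewrite divr_gt0// invr_gt0.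
  (* Half the radius puts [x k] in the interior of the ball around [q]; [radius m < e / 2] keeps
     that ball within distance [e] of [x k]. *)
  have [q [Dq xq]] : exists q, D q /\ ball (x k) (radius m / 2) q.
    have : closure D (x k) by rewrite clD.
    move=> /(_ (ball (x k) (radius m / 2)) (nbhsx_ballx _ _ r0))[q [Dq xq]].
    by exists q.
  exists [:: (j k, t q, m)].
    move=> c; rewrite inE => /eqP -> k' q' /= jk' Dq' tq'.
    have -> : k' = k by apply: jinj; rewrite ?inE.
    have -> : q' = q by apply: tinj; rewrite ?inE.
    apply/nbhs_ballP; exists (radius m / 2) => //= y xy.
    rewrite [radius m]splitr; apply: ball_triangle xy.
    exact: ball_sym.
  move=> y /= /(_ (j k, t q, m)); rewrite inE eqxx => /(_ isT k q erefl Dq erefl).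
  move=> /interior_subset qy; apply: eV.
  rewrite [e]splitr; apply: (@ball_triangle _ _ q).
    apply: le_ball xq; rewrite ler_pdivrMr// (le_trans (ltW me))//.
    lra.
  by apply: le_ball qy; exact: ltW.
have nO : nbhs (x : {ptws K -> T}) O by exact: open_nbhs_nbhs.
by move=> /(_ O nO)[l lx lO]; exists l.
Qed.

Lemma random_family_measurable (d : measure_display) (Omega : measurableType d)
    (K : Type) (T : topologicalType) (X : Omega -> K -> T) (A : set (K -> T)) :
  random_family X -> prod_sigma A -> measurable (X @^-1` A).
Proof.
move=> rX; suff : @prod_sigma K T `<=` [set A : set (K -> T) | measurable (X @^-1` A)] by apply.
apply: smallest_sub; last by move=> _ [k [B [bB ->]]]; exact: rX.
split => /=.
- by rewrite preimage_set0.
- by move=> B mB; rewrite setTD preimage_setC; exact: measurableC.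
- by move=> F mF; rewrite preimage_bigcup; exact: bigcupT_measurable.
Qed.

Lemma prod_measurable_fun_comp (R : realType) (d : measure_display)
    (Omega : measurableType d) (K : Type) (T : topologicalType)
    (X : Omega -> K -> T) (f : (K -> T) -> R) :
  random_family X -> prod_measurable_fun f -> measurable_fun setT (f \o X).
Proof.
move=> rX mf _ B mB; rewrite setTI comp_preimage.
exact: (random_family_measurable rX (mf B mB)).
Qed.

Lemma prod_measurable_fun_open (R : realType) (K : Type) (T : topologicalType)
  (f : (K -> T) -> R) : (forall B : set R, open B -> prod_sigma (f @^-1` B)) ->
  prod_measurable_fun f.
Proof.
move=> of_ B; move=> mB.
have {mB} : @measurable _ (g_sigma_algebraType (@RGenOpens.G R)) B.
  by rewrite -RGenOpens.measurableE.
move: B; apply: smallest_sub.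
  split => /=.
  - by rewrite preimage_set0; exact: sigma_algebra0.
  - by move=> B mB; rewrite setTD preimage_setC; exact: sigma_algebra_setC.
  - by move=> F mF; rewrite preimage_bigcup; exact: sigma_algebra_bigcup.
by move=> _ [x [y ->]]; apply: of_; exact: interval_open.
Qed.

Lemma continuous_prod_measurable_fun (R : realType) (K : Type)
    (T : completePseudoMetricType R) (h : {ptws K -> T} -> R) :
  polish T -> countable [set: K] -> continuous h ->
  prod_measurable_fun (h : (K -> T) -> R).
Proof.
move=> pT cK ch; apply: prod_measurable_fun_open => B oB.
by apply: open_prod_sigma => //; exact: open_comp.
Qed.

End measurability.

(** * Bounded random variables *)

Section bounded_functions.
Context (R : realType) (U : Type).
Implicit Types f g : U -> R.

Lemma bounded_funD f g : bounded_fun f -> bounded_fun g -> bounded_fun (fun x => f x + g x).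
Proof.
move=> [M fM] [N gN]; exists (M + N) => x /=.
by rewrite (le_trans (ler_normD _ _))// lerD.
Qed.

Lemma bounded_funM f g : bounded_fun f -> bounded_fun g -> bounded_fun (fun x => f x * g x).
Proof.
by move=> [M fM] [N gN]; exists (M * N) => x /=; rewrite normrM ler_pM.
Qed.

Lemma bounded_funZ (c : R) f : bounded_fun f -> bounded_fun (fun x => c * f x).
Proof.
by move=> [M fM]; exists (`|c| * M) => x /=; rewrite normrM ler_pM.
Qed.

Lemma bounded_fun_dist f g : bounded_fun f -> bounded_fun g ->
  bounded_fun (fun x => `|f x - g x|).
Proof.
move=> [M fM] [N gN]; exists (M + N) => x /=.
by rewrite normr_id (le_trans (ler_normB _ _))// lerD.
Qed.

Lemma bounded_fun_indic (A : set U) : bounded_fun (\1_A : U -> R).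
Proof.
by exists 1 => x; rewrite indicE; case: (_ \in _); rewrite ?normr1 ?normr0.
Qed.

Lemma bounded_fun_comp (V : Type) (Y : V -> U) f :
  bounded_fun f -> bounded_fun (fun w => f (Y w)).
Proof. by move=> [M fM]; exists M. Qed.

End bounded_functions.

Section bounded_expectation.
Context (R : realType) (d : measure_display) (Omega : measurableType d).
Variable P : probability Omega R.
Implicit Types (f g : Omega -> R) (A : set Omega).

Lemma integrable_bounded f :
  measurable_fun setT f -> bounded_fun f -> P.-integrable setT (EFin \o f).
Proof.
move=> mf [M fM]; apply: measurable_bounded_integrable => //.
  by rewrite -ge0_fin_numE ?fin_num_measure.
exists M; split; first exact: num_real.
by move=> N MN x _ /=; rewrite (le_trans (fM x))// ltW.
Qed.

Lemma integral_EFin_Rintegral f : measurable_fun setT f -> bounded_fun f ->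
  (\int[P]_w (f w)%:E)%E = (\int[P]_w f w)%:E.
Proof.
by move=> mf bf; rewrite /Rintegral fineK//; exact/integrable_fin_num/integrable_bounded.
Qed.

Lemma le_bounded_Rintegral f g : measurable_fun setT f -> bounded_fun f ->
  measurable_fun setT g -> bounded_fun g -> (forall x, f x <= g x) ->
  \int[P]_w f w <= \int[P]_w g w.
Proof.
by move=> mf bf mg bg fg; apply: le_Rintegral => // ; exact: integrable_bounded.
Qed.

Lemma Rintegral_indic A : measurable A -> \int[P]_w \1_A w = fine (P A).
Proof. by move=> mA; rewrite /Rintegral integral_indic// setIT. Qed.

Lemma probability_EFin A (e : R) : measurable A ->
  (P A <= e%:E)%E = (fine (P A) <= e).
Proof. by move=> mA; rewrite -[X in (X <= _)%E]fineK ?fin_num_measure// lee_fin. Qed.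

(** Continuity of [P] from above at the empty set. *)
Lemma probability_small_tail (F : nat -> set Omega) (e : R) :
  (forall n, measurable (F n)) -> {homo F : n m / (n <= m)%N >-> m `<=` n} ->
  \bigcap_n F n = set0 -> 0 < e -> exists n, (P (F n) <= e%:E)%E.
Proof.
move=> mF dF F0 e0.
have := @nonincreasing_cvg_mu _ _ _ P F.
rewrite F0 measure0 => /(_ _ mF measurable0) cv.
have /fine_cvgP[_ /cvgrPdist_le/(_ e e0)[N _ Ne]] : P \o F @ \oo --> 0%:E.
  apply: cv; first by rewrite (le_lt_trans (probability_le1 P (mF 0%N)))// ltry.
  by move=> n m nm; apply/subsetPset; exact: dF.
exists N; rewrite probability_EFin//.
have := Ne N (leqnn N); rewrite /= sub0r normrN; apply: le_trans.
exact: ler_norm.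
Qed.

(** Countable subadditivity with the geometric errors summing to [e], for an index type that is only
    injected into the naturals. *)
Lemma probability_countable_cover (C : Type) (j : C -> nat) (N : C -> set Omega)
    (A : set Omega) (e : R) :
  injective j -> 0 <= e -> measurable A -> (forall c, measurable (N c)) ->
  A `<=` \bigcup_c N c ->
  (forall c, (P (N c) <= (e / (2 ^ (j c).+1)%:R)%:E)%E) -> (P A <= e%:E)%E.
Proof.
move=> jinj e0 mA mN AN PN.
(* By injectivity [F n] is the event of the only index with code [n], or empty if [n] is no code. *)
pose F n := \bigcup_(c in [set c | j c = n]) N c.
have FE n : (exists2 c, F n = N c & j c = n) \/ F n = set0.
  have [[c jc]|nc] := pselect (exists c, j c = n).
    left; exists c => //; rewrite eqEsubset; split => x.
      by move=> [c' /= jc' Nx]; rewrite (jinj c c') ?jc.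
    by move=> Nx; exists c.
  by right; rewrite -subset0 => x [c jc _]; apply: nc; exists c.
have mF n : measurable (F n) by case: (FE n) => [[c -> _]|->].
apply: le_trans (epsilon_trick0 xpredT e0).
apply: (@le_trans _ _ (\sum_(0 <= n <oo) P (F n))%E).
  apply: measure_sigma_subadditive => // x /AN[c _ Nx].
  by exists (j c) => //; exists c.
apply: lee_nneseries => [n *|n *]; first exact: measure_ge0.
case: (FE n) => [[c -> <-]|->]; first exact: PN.
by rewrite measure0 lee_fin divr_ge0.
Qed.

End bounded_expectation.

(** * Compactness from total boundedness *)

(** An ultrafilter on [C] contains a ball of every radius, hence is Cauchy. It converges by
    completeness, and its limit lies in the closed set [C]. *)
Lemma closed_totally_bounded_compact (R : realType)
    (T : completePseudoMetricType R) (C : set T) :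
  closed C ->
  (forall r : R, 0 < r -> exists s : seq T, forall x, C x ->
     exists2 q, q \in s & ball q r x) ->
  compact C.
Proof.
move=> cC tb; rewrite compact_ultra => F FU FC.
have [PF _] := FU.
have cF : cauchy F.
  apply: cauchy_exP => r r0; have [s Cs] := tb _ r0.
  have : F [set x | exists2 q, q \in s & ball q r x] by exact: filterS FC.
  (* An ultrafilter that contains a finite union of balls contains one of them. *)
  elim: s {Cs} => [|q s IH].
    by move=> F0; have [x [q]] := filter_ex F0.
  move=> Fqs; have [Fq|nFq] := in_ultra_setVsetC (ball q r) FU; first by exists q.
  apply: IH; apply: filterS (filterI Fqs nFq) => x [[p + px] nqx].
  by rewrite inE => /predU1P[pq|ps]; [exfalso; apply: nqx; rewrite -pq|exists p].
have cvF : cvg F by exact: cauchy_cvg.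
exists (lim F); split => //.
apply: cC => B nB; have FB : F B by exact: cvF.
by have [x [Cx Bx]] := filter_ex (filterI FC FB); exists x.
Qed.

(** * Regularity of laws on countable products *)

Lemma ptws_coord_continuous (K : Type) (T : topologicalType) (k : K) :
  continuous (fun x : {ptws K -> T} => x k).
Proof. exact: (@proj_continuous {classic K} (fun=> T) k). Qed.

Lemma continuous_to_ptws (U : topologicalType) (K : Type) (T : topologicalType)
    (f : U -> {ptws K -> T}) :
  (forall k, continuous (fun u => f u k)) -> continuous f.
Proof.
move=> cf u; apply/cvg_sup => k W [_ [[V oV <-] /= Vfk] VW].
apply: filterS VW _; rewrite /nbhs/=.
by apply: (cf k u); exact: open_nbhs_nbhs.
Qed.

Lemma restr_continuous (I : Type) (T : topologicalType) (J : set I) :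
  continuous (@restr I T J : {ptws I -> T} -> {ptws {i | J i} -> T}).
Proof. by apply: continuous_to_ptws => k; exact: ptws_coord_continuous. Qed.

Lemma continuous_comp_restr (I : Type) (T U : topologicalType) (J : set I)
    (h : {ptws {i | J i} -> T} -> U) :
  continuous h -> continuous (fun x : {ptws I -> T} => h (@restr I T J x)).
Proof.
move=> ch x; exact: (@continuous_comp _ _ _
  (@restr I T J : {ptws I -> T} -> {ptws {i | J i} -> T}) h x
  (@restr_continuous _ _ J x) (ch _)).
Qed.

Lemma random_family_restr (d : measure_display) (Omega : measurableType d)
    (I : Type) (T : topologicalType) (X : Omega -> I -> T) (J : set I) :
  random_family X -> random_family (@restr I T J \o X).
Proof. by move=> rX i; exact: rX. Qed.

Lemma countable_sig (I : Type) (J : set I) :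
  countable [set: I] -> countable [set: {i | J i}].
Proof.
move=> /countable_injP[j jinj]; apply/countable_injP; exists (j \o sval).
move=> [a Ja] [b Jb] _ _ /= /jinj ab; have {}ab : a = b by apply: ab; rewrite inE.
by subst b; congr exist; exact: Prop_irrelevance.
Qed.

(** The closed sets are the closures of the sets of points whose ball of radius [n.+1%:R^-1] lies in
    [B]. Taking closures does not leave [B]: a limit point belongs to the ball of a nearby point of
    the set. *)
Lemma open_regular (R : realType) (T : completePseudoMetricType R) (B : set T) :
  open B -> exists F : nat -> set T, [/\ (forall n, closed (F n)),
    {homo F : n m / (n <= m)%N >-> n `<=` m} & B = \bigcup_n F n].
Proof.
move=> oB.
pose G (r : R) := [set x | forall y, ball x r y -> B y].
have r0 n : 0 < n.+1%:R^-1 :> R by rewrite invr_gt0.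
have GB r : 0 < r -> closure (G r) `<=` B.
  move=> rgt0 x /(_ _ (nbhsx_ballx x r rgt0))[y [Gy xy]].
  by apply: Gy; exact: ball_sym.
exists (fun n => closure (G n.+1%:R^-1)); split.
- by move=> n; exact: closed_closure.
- move=> n m nm; apply: closureS => x Gx y xy; apply: Gx; apply: le_ball xy.
  by rewrite lef_pV2 ?posrE// ler_nat.
rewrite eqEsubset; split => x; last by move=> [n _ /GB]; exact.
move=> Bx; have /nbhs_ballP[e /= e0 eB] : nbhs x B by exact: open_nbhs_nbhs.
have [n] := @ltr_add_invr R 0 e e0; rewrite add0r => ne.
exists n => //; apply: subset_closure => y xy; apply: eB.
by apply: le_ball xy; exact: ltW.
Qed.

Section regularity.
Context (R : realType) (d : measure_display) (Omega : measurableType d).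
Context (P : probability Omega R) (K : Type) (T : completePseudoMetricType R).
Variable X : Omega -> K -> T.

Definition regular_event (A : set (K -> T)) := forall e : R, 0 < e ->
  exists F O : set {ptws K -> T},
    [/\ closed F, open O, F `<=` A, A `<=` O & (P (X @^-1` (O `\` F)) <= e%:E)%E].

Hypotheses (pT : polish T) (cK : countable [set: K]) (rX : random_family X).

Lemma open_preimage_measurable (O : set {ptws K -> T}) :
  open O -> measurable (X @^-1` O).
Proof. by move=> oO; exact: (random_family_measurable rX (open_prod_sigma pT cK oO)). Qed.

Lemma closed_preimage_measurable (F : set {ptws K -> T}) :
  closed F -> measurable (X @^-1` F).
Proof.
move=> cF; rewrite -[F]setCK preimage_setC; apply: measurableC.
exact: (open_preimage_measurable (closed_openC cF)).
Qed.

Lemma regular_event_setC (A : set (K -> T)) : regular_event A -> regular_event (~` A).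
Proof.
move=> rA e e0; have [F [U [cF oU FA AU PFU]]] := rA e e0.
exists (~` U), (~` F); split => //.
- exact: open_closedC.
- exact: closed_openC.
- exact: subsetC.
- exact: subsetC.
- by rewrite setDE setCK setIC.
Qed.

(** The open sets are united at a total cost [e / 2]. The union of the closed sets need not be
    closed, so it is cut at a finite stage, which costs another [e / 2]. *)
Lemma regular_event_bigcup (A : nat -> set (K -> T)) :
  (forall n, regular_event (A n)) -> regular_event (\bigcup_n A n).
Proof.
move=> rA e e0.
have e20 : 0 < e / 2 by rewrite divr_gt0.
have /choice[FO PFO] n : exists FO : set {ptws K -> T} * set {ptws K -> T},
    [/\ closed FO.1, open FO.2, FO.1 `<=` A n, A n `<=` FO.2 &
      (P (X @^-1` (FO.2 `\` FO.1)) <= (e / 2 / (2 ^ n.+1)%:R)%:E)%E].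
  have [|F [U ?]] := rA n (e / 2 / (2 ^ n.+1)%:R); last by exists (F, U).
  by rewrite divr_gt0// ltr0n expn_gt0.
pose F n := (FO n).1; pose O n := (FO n).2.
have cF n : closed (F n) by have [] := PFO n.
have oO n : open (O n) by have [] := PFO n.
pose G N := \big[setU/set0]_(n < N) F n.
have cG N : closed (G N) by exact: closed_bigsetU.
have GF N : G N `<=` \bigcup_n F n.
  by rewrite /G -bigcup_mkord => x [n _ Fx]; exists n.
have oUO : open (\bigcup_n O n) by exact: bigcup_open.
have mF n : measurable (X @^-1` F n) by exact: closed_preimage_measurable.
have mO n : measurable (X @^-1` O n) by exact: open_preimage_measurable.
have mG N : measurable (X @^-1` G N) by exact: closed_preimage_measurable.
have mUF : measurable (X @^-1` (\bigcup_n F n)).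
  by rewrite preimage_bigcup; exact: bigcupT_measurable.
have mUO : measurable (X @^-1` (\bigcup_n O n)) by exact: open_preimage_measurable.
have [N PN] : exists N, (P (X @^-1` (\bigcup_n F n) `\` X @^-1` G N) <= (e / 2)%:E)%E.
  apply: (@probability_small_tail _ _ _ P
      (fun N => X @^-1` (\bigcup_n F n) `\` X @^-1` G N) (e / 2)) => //.
  - by move=> n; exact: measurableD.
  - move=> n m nm w [Fw nGw]; split => //; apply: contra_not nGw.
    rewrite /preimage/= /G -!bigcup_mkord => -[i /= ni Fi]; exists i => //=.
    exact: leq_trans nm.
  - rewrite -subset0 => w wn; have [[n _ Fn] _] := wn 0%N I.
    have [_] := wn n.+1 I; apply.
    by rewrite /preimage/= /G -bigcup_mkord; exists n => /=.
exists (G N), (\bigcup_n O n); split => //.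
- apply: (subset_trans (GF N)) => x [n _ Fx]; exists n => //.
  by have [_ _ + _ _] := PFO n; apply.
- by move=> x [n _ Ax]; exists n => //; have [_ _ _ + _] := PFO n; apply.
rewrite [e]splitr EFinD.
(* A point of some [O n] outside [G N] either lies in some [F m] that the cut misses, or in no [F m]
   at all and so in [O n] minus [F n]. *)
apply: (@le_trans _ _ (P ((\bigcup_n (X @^-1` O n `\` X @^-1` F n)) `|`
    (X @^-1` (\bigcup_n F n) `\` X @^-1` G N)))%E).
  apply: le_measure; rewrite ?inE.
  - exact: (measurableD mUO (mG N)).
  - apply: measurableU; last exact: measurableD.
    by apply: bigcupT_measurable => n; exact: measurableD.
  - move=> w [[n _ Ow] nGw].
    have [[m _ Fm]|nF] := pselect ((\bigcup_n F n) (X w)).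
      by right; split => //; exists m.
    by left; exists n => //; split => // Fn; apply: nF; exists n.
apply: (le_trans (measureU2 _ _ _)).
- by apply: bigcupT_measurable => n; exact: measurableD.
- exact: measurableD.
apply: leeD => //.
apply: (@probability_countable_cover _ _ _ P nat id
  (fun n => X @^-1` O n `\` X @^-1` F n)) => //.
- exact: ltW.
- by apply: bigcupT_measurable => n; exact: measurableD.
- by move=> n; exact: measurableD.
- by move=> n; have [] := PFO n.
Qed.

Lemma regular_event0 : regular_event set0.
Proof.
move=> e e0; exists set0, set0; split => //.
- exact: closed0.
- exact: open0.
- by rewrite setD0 preimage_set0 measure0 lee_fin ltW.
Qed.

Lemma regular_event_open (k : K) (B : set T) :
  open B -> regular_event [set x | B (x k)].
Proof.
move=> oB e e0; have [F [cF ndF BE]] := open_regular oB.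
pose H n : set {ptws K -> T} := [set x | F n (x k)].
have cH n : closed (H n).
  by apply: (preimage_closed (D := F n)) => // x _; exact: ptws_coord_continuous.
have oH : open [set x : {ptws K -> T} | B (x k)].
  by apply: open_comp => // x _; exact: ptws_coord_continuous.
have mH n : measurable (X @^-1` H n) by exact: closed_preimage_measurable.
have mB : measurable (X @^-1` [set x : {ptws K -> T} | B (x k)]).
  exact: open_preimage_measurable.
have HB n : H n `<=` [set x | B (x k)] by move=> x Hx; rewrite /= BE; exists n.
have [|||N PN] := @probability_small_tail _ _ _ P
  (fun N => X @^-1` ([set x | B (x k)] `\` H N)) e _ _ _ e0.
- by move=> n; exact: (measurableD mB (mH n)).
- move=> n m nm w [Bw nHw]; split => //; apply: contra_not nHw.
  exact: (ndF _ _ nm).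
- rewrite -subset0 => w wn; have [Bw _] := wn 0%N I.
  by move: Bw; rewrite /= BE => -[n _ Fn]; have [_] := wn n I; apply.
by exists (H N), [set x | B (x k)]; split; [exact: cH|exact: oH|exact: HB| |exact: PN].
Qed.

(** Two nested generation arguments: the regular events form a sigma-algebra, and for a fixed
    coordinate so do the sets [B] whose cylinder is regular, among them the open sets. *)
Lemma prod_sigma_regular (A : set (K -> T)) : prod_sigma A -> regular_event A.
Proof.
have saC : sigma_algebra setT regular_event.
  split; first exact: regular_event0.
  - by move=> A' rA; rewrite setTD; exact: regular_event_setC.
  - exact: regular_event_bigcup.
move: A; apply: smallest_sub => // _ [k [B [+ ->]]].
move: B; apply: smallest_sub; last by move=> B; exact: regular_event_open.
split => /=.
- rewrite (_ : [set x | _] = set0); first exact: regular_event0.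
  by rewrite -subset0.
- move=> B rB; rewrite (_ : [set x | _] = ~` [set x | B (x k)]).
    exact: regular_event_setC.
  by rewrite eqEsubset; split => x /=; [case | split].
- move=> F rF; rewrite (_ : [set x | _] = \bigcup_n [set x | F n (x k)]).
    exact: regular_event_bigcup.
  by rewrite eqEsubset; split.
Qed.

End regularity.

(** * Uniform tightness *)

Section tightness.
Context (R : realType) (T : completePseudoMetricType R).

(* Balls of a pseudometric space need not be open, hence the interiors. *)
Definition ball_union (s : seq T) (r : R) : set T :=
  [set x | exists2 q, q \in s & (interior (ball q r)) x].

Lemma open_ball_union s r : open (ball_union s r).
Proof.
rewrite (_ : ball_union s r = \bigcup_(q in [set` s]) (interior (ball q r))).
  by apply: bigcup_open => q _; exact: open_interior.
by rewrite eqEsubset; split => x [q ? ?]; exists q.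
Qed.

Lemma closure_ball_union s (r : R) x : 0 < r -> closure (ball_union s r) x ->
  exists2 q, q \in s & ball q (r + r) x.
Proof.
move=> r0 /(_ _ (nbhsx_ballx x r r0))[y [[q qs /interior_subset qy] xy]].
by exists q => //; apply: ball_triangle qy _; exact: ball_sym.
Qed.

(** This lets weak convergence see the unions of balls: [g] dominates the indicator of the
    complement at radius [r] and is dominated by that at radius [r / 2]. *)
Lemma ball_union_separation s (r : R) : 0 < r -> exists g : T -> R,
  [/\ continuous g, (forall x, 0 <= g x <= 1),
    (forall x, ball_union s (r / 2) x -> g x = 0) &
    (forall x, ~ ball_union s r x -> g x = 1)].
Proof.
move=> r0; pose A := ball_union s (r / 2); pose B := ~` ball_union s r.
have r40 : 0 < r / 4 by rewrite divr_gt0.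
have sep : uniform_separator A B.
  apply: uniform_separatorW; exists [set xy | ball xy.1 (r / 4) xy.2].
    by rewrite -entourage_ballE; exists (r / 4).
  rewrite -subset0 => -[x y] /= [[[q qs /interior_subset qx] nBy] xy]; apply: nBy.
  exists q => //; apply/nbhs_ballP; exists (r / 4) => // z yz.
  (* One quarter is spent on the entourage, the other on reaching the interior of the larger
     ball. *)
  have -> : r = r / 2 + r / 4 + r / 4 by lra.
  exact: ball_triangle (ball_triangle qx xy) yz.
exists (Urysohn A B : T -> R); split.
- exact: Urysohn_continuous.
- move=> x; have /= := @Urysohn_range T R A B (Urysohn A B x).
  by rewrite in_itv /=; apply; exists x.
- by move=> x Ax; apply: (Urysohn_sub0 sep); exists x.
- by move=> x Bx; apply: (Urysohn_sub1 sep); exists x.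
Qed.

Lemma borel_open (B : set T) : open B -> borel_sets B.
Proof. exact: sub_sigma_algebra. Qed.

(** The balls around the first [n] points of a dense sequence increase to the whole space, so the
    complements have small probability. *)
Lemma ball_union_tight (d : measure_display) (Omega : measurableType d)
    (P : probability Omega R) (Y : Omega -> T) (r e : R) :
  polish T -> (forall B, borel_sets B -> measurable (Y @^-1` B)) ->
  0 < r -> 0 < e ->
  exists s, (P (~` (Y @^-1` ball_union s r)) <= e%:E)%E.
Proof.
move=> [_ [D [cD clD]]] mY r0 e0.
(* A dense set cannot be empty, because [Y] takes a value; hence it is enumerated by a sequence
   [u]. *)
have [D0|[u]] := pfcard_geP cD.
  have : [set: T] (Y point) by [].
  by rewrite -clD D0 closure0.
pose F n := ~` (Y @^-1` ball_union (mkseq u n) r).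
have [|||n PF] := @probability_small_tail _ _ _ P F e _ _ _ e0.
- move=> n; apply: measurableC; apply: mY; apply: borel_open; exact: open_ball_union.
- move=> n m nm; apply: subsetC => w [q /mapP[i]]; rewrite mem_iota add0n => /= ni -> uY.
  by exists (u i) => //; apply: map_f; rewrite mem_iota add0n /= (leq_trans ni).
- rewrite -subset0 => w wn.
  have r20 : 0 < r / 2 by rewrite divr_gt0.
  have : closure D (Y w) by rewrite clD.
  move=> /(_ _ (nbhsx_ballx (Y w) (r / 2) r20))[q [Dq Yq]].
  have [i _ uiq] := @surj _ _ _ _ u q Dq.
  apply: (wn i.+1 I); exists q.
    by rewrite -uiq; apply: map_f; rewrite mem_iota add0n /=.
  apply/nbhs_ballP; exists (r / 2) => // z Yz.
  by rewrite [r]splitr; apply: ball_triangle Yz; exact: ball_sym.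
by exists (mkseq u n).
Qed.

Context (K : Type) (d : nat -> measure_display) (Omega : forall k, measurableType (d k)).
Context (P : forall k, probability (Omega k) R) (Xs : forall k, Omega k -> K -> T).
Context (d0 : measure_display) (Omega0 : measurableType d0).
Context (P0 : probability Omega0 R) (X : Omega0 -> K -> T).
Arguments Xs : clear implicits.
Hypotheses (pT : polish T) (cK : countable [set: K]).
Hypotheses (rXs : forall k, random_family (Xs k)) (rX : random_family X).
Hypothesis XsX : cvg_in_distribution P Xs P0 X.

Lemma continuous_random_measurable (d' : measure_display)
    (Omega' : measurableType d') (Y : Omega' -> K -> T) (h : {ptws K -> T} -> R) :
  random_family Y -> continuous h -> measurable_fun setT (fun w => h (Y w)).
Proof.
move=> rY ch.
exact: (prod_measurable_fun_comp rY (continuous_prod_measurable_fun pT cK ch)).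
Qed.

Lemma cvg_in_distribution_Rintegral (h : {ptws K -> T} -> R) :
  continuous h -> bounded_fun h ->
  (fun k => \int[P k]_w h (Xs k w)) @ \oo --> \int[P0]_w h (X w).
Proof.
move=> ch bh; have := XsX ch bh.
rewrite integral_EFin_Rintegral; last 2 first.
- exact: continuous_random_measurable.
- exact: bounded_fun_comp.
by move=> /fine_cvgP[].
Qed.

(** Tightness of the limit law at radius [r / 2] and level [e / 2] bounds the mean of the separating
    function [g]. Weak convergence transfers the bound, with [e], to late indices, where [g]
    dominates the complement at radius [r]. *)
Lemma ball_union_eventually_tight (i : K) (r e : R) : 0 < r -> 0 < e ->
  exists s, \forall k \near \oo,
    (P k (~` ((fun w => Xs k w i) @^-1` ball_union s r)) <= e%:E)%E.
Proof.
move=> r0 e0.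
have r20 : 0 < r / 2 by rewrite divr_gt0.
have e20 : 0 < e / 2 by rewrite divr_gt0.
have [s Ps] := ball_union_tight P0 pT (rX i) r20 e20.
exists s; have [g [cg g01 g0 g1]] := ball_union_separation s r0.
have bg : bounded_fun g.
  by exists 1 => x; have /andP[g_ge0 g_le1] := g01 x; rewrite ger0_norm.
have cgi : continuous (fun x : {ptws K -> T} => g (x i)).
  by move=> x; apply: continuous_comp; [exact: ptws_coord_continuous|exact: cg].
have cv := cvg_in_distribution_Rintegral cgi
  (bounded_fun_comp (fun x : {ptws K -> T} => x i) bg).
have m0 : measurable (~` ((fun w => X w i) @^-1` ball_union s (r / 2))).
  by apply: measurableC; apply: rX; apply: borel_open; exact: open_ball_union.
have E0 : \int[P0]_w g (X w i) <= e / 2.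
  rewrite probability_EFin// -Rintegral_indic// in Ps.
  apply: le_trans Ps; apply: le_bounded_Rintegral => //.
  - exact: (continuous_random_measurable rX cgi).
  - exact: bounded_fun_comp.
  - exact: bounded_fun_indic.
  - move=> w; rewrite indicE; case: (boolP (_ \in _)) => [_|].
      by have /andP[] := g01 (X w i).
    by rewrite notin_setE /= => /contrapT Aw; rewrite g0.
have : \forall k \near \oo, \int[P k]_w g (Xs k w i) < e.
  by apply: (cvgr_lt _ cv); rewrite (le_lt_trans E0)// ltr_pdivrMr// ltr_pMr// ltr1n.
apply: filterS => k Ek.
have mk : measurable (~` ((fun w => Xs k w i) @^-1` ball_union s r)).
  by apply: measurableC; apply: rXs; apply: borel_open; exact: open_ball_union.
rewrite probability_EFin// -Rintegral_indic//; apply: le_trans (ltW Ek).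
apply: le_bounded_Rintegral => //.
- exact: bounded_fun_indic.
- exact: (continuous_random_measurable (rXs k) cgi).
- exact: bounded_fun_comp.
- move=> w; rewrite indicE; case: (boolP (_ \in _)) => [|_].
    by rewrite inE /= => nB; rewrite g1.
  by have /andP[] := g01 (Xs k w i).
Qed.

(** The finitely many early laws and the limit law are tight one by one. Concatenating their lists
    of centres with the list for the late indices serves all laws at once. *)
Lemma ball_union_uniformly_tight (i : K) (r e : R) : 0 < r -> 0 < e ->
  exists s, (forall k, P k (~` ((fun w => Xs k w i) @^-1` ball_union s r)) <= e%:E)%E /\
    (P0 (~` ((fun w => X w i) @^-1` ball_union s r)) <= e%:E)%E.
Proof.
move=> r0 e0.
have [s [N _ Ns]] := ball_union_eventually_tight i r0 e0.
have /choice[t tP] k := ball_union_tight (P k) pT (rXs k i) r0 e0.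
have [t0 t0P] := ball_union_tight P0 pT (rX i) r0 e0.
exists (t0 ++ s ++ flatten (mkseq t N)).
have mono (d' : measure_display) (Omega' : measurableType d')
    (Q : probability Omega' R) (Y : Omega' -> K -> T) (u v : seq T) :
    random_family Y -> ball_union u r `<=` ball_union v r ->
    (Q (~` ((fun w => Y w i) @^-1` ball_union u r)) <= e%:E)%E ->
    (Q (~` ((fun w => Y w i) @^-1` ball_union v r)) <= e%:E)%E.
  move=> rY uv; apply: le_trans; apply: le_measure; rewrite ?inE.
  - by apply: measurableC; apply: rY; apply: borel_open; exact: open_ball_union.
  - by apply: measurableC; apply: rY; apply: borel_open; exact: open_ball_union.
  - by apply: subsetC => w /uv.
split; last first.
  apply: (mono _ _ _ _ _ _ rX _ t0P).
  by move=> x [q qt xq]; exists q; rewrite // mem_cat qt.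
move=> k; have [Nk|kN] := leqP N k.
  apply: (mono _ _ _ _ _ _ (rXs k) _ (Ns k Nk)).
  by move=> x [q qs xq]; exists q; rewrite // !mem_cat qs orbT.
apply: (mono _ _ _ _ _ _ (rXs k) _ (tP k)).
move=> x [q qt xq]; exists q => //; rewrite !mem_cat; apply/orP; right; apply/orP; right.
apply/flattenP; exists (t k) => //; apply: map_f; rewrite mem_iota add0n /=.
exact: kN.
Qed.

(** For each coordinate and each radius a finite union of balls is chosen, with errors summing to
    [e] over all pairs. Intersecting the closures over the radii gives a compact set in each
    coordinate, and Tychonoff's theorem makes the product compact. *)
Lemma uniformly_tight (e : R) : 0 < e ->
  exists C : set {ptws K -> T}, [/\ compact C, closed C,
    (forall k, P k (~` (Xs k @^-1` C)) <= e%:E)%E & (P0 (~` (X @^-1` C)) <= e%:E)%E].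
Proof.
move=> e0; have /countable_injP[j jinj] := cK.
pose code (c : K * nat) := pickle (j c.1, c.2).
have code_inj : injective code.
  move=> [a m] [b n] /(pcan_inj pickleK) [jab <-]; congr pair.
  by apply: jinj; rewrite ?inE.
pose err c : R := e / (2 ^ (code c).+1)%:R.
have err0 c : 0 < err c by rewrite divr_gt0// ltr0n expn_gt0.
pose rad (m : nat) : R := m.+1%:R^-1.
have rad0 m : 0 < rad m by rewrite invr_gt0.
have /choice[s sP] c := ball_union_uniformly_tight c.1 (rad0 c.2) (err0 c).
pose Ci i := \bigcap_m closure (ball_union (s (i, m)) (rad m)).
pose C : set {ptws K -> T} := [set x | forall i, Ci i (x i)].
have cCi i : closed (Ci i) by apply: closed_bigI => m _; exact: closed_closure.
have kCi i : compact (Ci i).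
  apply: closed_totally_bounded_compact => // r r0.
  (* Passing to the closure doubles the radius, whence [r / 2]. *)
  have [m] := @ltr_add_invr R 0 (r / 2) (divr_gt0 r0 (ltr0Sn _ _)).
  rewrite add0r -/(rad m) => mr; exists (s (i, m)) => x /(_ m I).
  move=> /(closure_ball_union (rad0 m))[q qs xq]; exists q => //.
  by apply: le_ball xq; rewrite [leRHS]splitr lerD// ltW.
have clC : closed C.
  rewrite (_ : C = \bigcap_i (fun x : {ptws K -> T} => x i) @^-1` Ci i).
    apply: closed_bigI => i _; apply: preimage_closed => // x _.
    exact: ptws_coord_continuous.
  by rewrite eqEsubset; split => x; [move=> Cx i _; exact: Cx|move=> Cx i; exact: Cx].
have tightC (d' : measure_display) (Omega' : measurableType d')
    (Q : probability Omega' R) (Y : Omega' -> K -> T) : random_family Y ->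
    (forall c, Q (~` ((fun w => Y w c.1) @^-1` ball_union (s c) (rad c.2)))
       <= (err c)%:E)%E ->
    (Q (~` (Y @^-1` C)) <= e%:E)%E.
  move=> rY QY; apply: (probability_countable_cover (P := Q) code_inj (ltW e0) _ _ _ QY).
  - apply: measurableC; exact: (closed_preimage_measurable pT cK rY clC).
  - by move=> c; apply: measurableC; apply: rY; apply: borel_open; exact: open_ball_union.
  - move=> w nC.
    have /existsNP[i nCi] : ~ forall i, Ci i (Y w i) by [].
    have /existsNP[m nm] : ~ forall m, closure (ball_union (s (i, m)) (rad m)) (Y w i).
      by move=> h; apply: nCi => m _.
    by exists (i, m) => //; apply: contra_not nm => Bm; exact: subset_closure.
exists C; split => //.
- exact: (@tychonoff {classic K} (fun=> T) Ci kCi).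
- by move=> k; apply: tightC => // c; have [] := sP c.
- by apply: tightC => // c; have [] := sP c.
Qed.

End tightness.

(** * Approximation of upper events *)

Definition upper_event (K T : Type) (le : T -> T -> Prop) (A : set (K -> T)) :=
  forall x y, A x -> (forall k, le (x k) (y k)) -> A y.

Section approximation.
Context (R : realType) (T : completePseudoMetricType R) (le : T -> T -> Prop).
Context (K : Type) (d : nat -> measure_display) (Omega : forall k, measurableType (d k)).
Context (P : forall k, probability (Omega k) R) (Xs : forall k, Omega k -> K -> T).
Context (d0 : measure_display) (Omega0 : measurableType d0).
Context (P0 : probability Omega0 R) (X : Omega0 -> K -> T).
Arguments Xs : clear implicits.
Hypotheses (pT : polish T) (cle : closed_partial_order le) (cK : countable [set: K]).
Hypotheses (rXs : forall k, random_family (Xs k)) (rX : random_family X).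
Hypothesis XsX : cvg_in_distribution P Xs P0 X.

Lemma compact_upset_closed (D : set {ptws K -> T}) : compact D ->
  closed [set x : {ptws K -> T} |
    exists2 z : {ptws K -> T}, D z & forall k, le (z k) (x k)].
Proof.
move=> kD; have [_ _ _ cle'] := cle.
apply: (@compact_downset_closed _ _ (fun x y => le y x)) kD.
rewrite (_ : [set p | _] = (fun p : T * T => (p.2, p.1)) @^-1` [set p | le p.1 p.2]) //.
by apply: preimage_closed => // p _; exact: swap_continuous.
Qed.

(** On [C] the indicator of [O] lies between [phi] and [psi], and these two differ there only inside
    [V] minus [F], a set of small probability in the application. *)
Lemma upper_event_separation (A : set (K -> T)) (C F V : set {ptws K -> T}) :
  upper_event le A -> compact C -> closed C -> closed F -> open V ->
  F `<=` A -> A `<=` V ->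
  exists (O : set {ptws K -> T}) (phi psi : {ptws K -> T} -> R),
  [/\ open O, upper_event le O, continuous phi & continuous psi] /\
  (forall x, 0 <= phi x <= 1) /\ (forall x, 0 <= psi x <= 1) /\
  [/\ (forall x, F x -> C x -> phi x = 1), (forall x, ~ O x -> phi x = 0),
    (forall x, O x -> C x -> psi x = 1), (forall x, ~ V x -> psi x = 0) &
    (forall x, O x -> C x -> V x)].
Proof.
move=> uA kC cC cF oV FA AV.
have [le_xx _ le_tr cle'] := cle.
pose F1 := F `&` C.
have kF1 : compact F1 by rewrite /F1 setIC; exact: compact_closedI.
pose upF1 := [set x : {ptws K -> T} |
    exists2 z : {ptws K -> T}, F1 z & forall k, le (z k) (x k)].
have kG : compact (C `&` upF1).
  by apply: compact_closedI => //; exact: compact_upset_closed.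
have cV : closed (~` V) by exact: open_closedC.
have GV0 : (C `&` upF1) `&` (~` V) = set0.
  rewrite -subset0 => x [[_ [z [Fz _] zx]] nVx]; apply/nVx/AV.
  by apply: uA zx; exact: FA.
have [u [cu u01 uG uV]] := @compact_closed_Urysohn R _ _ _ kG cV GV0.
pose D := C `&` [set x | u x <= 1 / 2].
have kD : compact D.
  apply: compact_closedI => //.
  apply: (preimage_closed (f := u) (D := [set y | y <= 1 / 2])) => [x _|].
    exact: cu.
  exact: closed_le.
pose downD := [set x : {ptws K -> T} |
    exists2 z : {ptws K -> T}, D z & forall k, le (x k) (z k)].
have cD : closed downD by exact: compact_downset_closed.
(* A point of [C] above a point of [F1] lies in the compact set where [u] is 1, so it cannot satisfy
   [u <= 1 / 2]. *)
have F1D0 : F1 `&` downD = set0.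
  rewrite -subset0 => x [F1x [z [Cz /= uz] xz]]; move: uz.
  rewrite uG; last by split => //; exists x.
  by lra.
have [phi [cphi phi01 phi1 phi0]] := @compact_closed_Urysohn R _ _ _ kF1 cD F1D0.
have uD x : ~ downD x -> C x -> 1 / 2 < u x.
  move=> nDx Cx; rewrite ltNge; apply/negP => ux; apply: nDx.
  by exists x.
exists (~` downD), phi, (fun x => Num.min 1 (2 * u x)); do !split => //.
- exact: closed_openC.
- move=> x y nDx xy [z Dz yz]; apply: nDx; exists z => // k.
  exact: le_tr (xy k) (yz k).
- move=> x; apply: (@continuous_min R _ (cst 1) (fun x => 2 * u x)).
    exact: cst_continuous.
  by apply: continuousM; [exact: cst_continuous|exact: cu].
- move=> x; have := u01 x.
  by rewrite le_min ler01 ge_min lexx /= andbT => /andP[u0 _]; rewrite mulr_ge0.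
- by move=> x Fx Cx; rewrite phi1.
- by move=> x /contrapT Dx; rewrite phi0.
- move=> x nDx Cx; have ux := uD x nDx Cx; rewrite min_l//; lra.
- by move=> x nVx; rewrite uV// mulr0 min_r.
- move=> x nDx Cx; have := uD x nDx Cx; apply: contraPP => nVx; rewrite uV//; lra.
Qed.

(** Tightness and regularity cost [e / 4] each. Under [P0] both the distance of [phi] from the
    indicator of [A] and the mean of [psi - phi] are therefore at most [e / 2]; the latter bound
    concerns a continuous function and passes to [P k]. *)
Lemma upper_event_approximation (A : set (K -> T)) (e : R) :
  prod_sigma A -> upper_event le A -> 0 < e ->
  exists (O : set {ptws K -> T}) (phi : {ptws K -> T} -> R),
  [/\ open O, upper_event le O, continuous phi & (forall x, 0 <= phi x <= 1)] /\
  \int[P0]_w `|\1_A (X w) - phi (X w)| <= e /\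
  \forall k \near \oo, \int[P k]_w `|\1_O (Xs k w) - phi (Xs k w)| <= e.
Proof.
move=> mA uA e0.
have e40 : 0 < e / 4 by rewrite divr_gt0.
have [C [kC cC PC P0C]] := uniformly_tight pT cK rXs rX XsX e40.
have [F [V [cF oV FA AV PVF]]] := prod_sigma_regular P0 pT cK rX mA e40.
have [U [phi [psi [[oU uU cphi cpsi] [phi01 [psi01 [phi1 phi0 psi1 psi0 UCV]]]]]]] :=
  upper_event_separation uA kC cC cF oV FA AV.
have mVF : measurable (X @^-1` (V `\` F)).
  exact: (measurableD (open_preimage_measurable pT cK rX oV)
    (closed_preimage_measurable pT cK rX cF)).
have mC : measurable (~` (X @^-1` C)).
  by apply: measurableC; exact: (closed_preimage_measurable pT cK rX cC).
have mCk k : measurable (~` (Xs k @^-1` C)).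
  by apply: measurableC; exact: (closed_preimage_measurable pT cK (rXs k) cC).
have bphi : bounded_fun phi.
  by exists 1 => x; have /andP[? ?] := phi01 x; rewrite ger0_norm.
have bpsi : bounded_fun psi.
  by exists 1 => x; have /andP[? ?] := psi01 x; rewrite ger0_norm.
have bpsiphi : bounded_fun (fun x => psi x - phi x).
  apply: bounded_funD => //; case: bphi => M phiM; exists M => x.
  by rewrite normrN.
have cpsiphi : continuous (fun x => psi x - phi x).
  by move=> x; apply: continuousB; [exact: cpsi|exact: cphi].
have err (h : Omega0 -> R) : measurable_fun setT h -> bounded_fun h ->
    (forall w, h w <= \1_(X @^-1` (V `\` F)) w + \1_(~` (X @^-1` C)) w) ->
    \int[P0]_w h w <= e / 2.
  move=> mh bh hle.
  apply: (@le_trans _ _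
    (\int[P0]_w (\1_(X @^-1` (V `\` F)) w + \1_(~` (X @^-1` C)) w))).
    apply: le_bounded_Rintegral => //; first exact: measurable_funD.
    by apply: bounded_funD; exact: bounded_fun_indic.
  rewrite RintegralD//; last 2 first.
  - by apply: integrable_bounded => //; exact: bounded_fun_indic.
  - by apply: integrable_bounded => //; exact: bounded_fun_indic.
  rewrite !Rintegral_indic//.
  rewrite !probability_EFin// in PVF P0C; lra.
have mphi0 : measurable_fun setT (fun w => phi (X w)).
  exact: (continuous_random_measurable pT cK rX cphi).
have mphik k : measurable_fun setT (fun w => phi (Xs k w)).
  exact: (continuous_random_measurable pT cK (rXs k) cphi).
have ind1 (V' : Type) (B : set V') x : B x -> \1_B x = 1 :> R.
  by move=> Bx; rewrite indicE mem_set.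
have ind0 (V' : Type) (B : set V') x : ~ B x -> \1_B x = 0 :> R.
  by move=> Bx; rewrite indicE memNset.
have ind01 (V' : Type) (B : set V') x : 0 <= (\1_B x : R) <= 1.
  by rewrite indicE; case: (_ \in _); rewrite lexx ler01.
exists U, phi; split=> //; split.
  apply: (le_trans (err _ _ _ _)).
  - apply: measurableT_comp => //; apply: measurable_funB => //.
    exact: (@measurable_indic _ _ R setT (X @^-1` A) (random_family_measurable rX mA)).
  - apply: bounded_fun_dist; last exact: bounded_fun_comp.
    exact: (bounded_fun_indic R (X @^-1` A)).
  - move=> w; have := phi01 (X w).
    have := ind01 _ (X @^-1` (V `\` F)) w; have := ind01 _ A (X w).
    rewrite ler_norml => iA iVF phiw.
    have [Cw|nCw] := pselect (C (X w)); last first.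
      by rewrite (ind1 _ (~` (X @^-1` C)))//; apply/andP; split; lra.
    rewrite (ind0 _ (~` (X @^-1` C)))//.
    have [Vw|nVw] := pselect (V (X w)); last first.
      have phiw0 : phi (X w) = 0 by apply: phi0 => /UCV/(_ Cw).
      have Aw0 : \1_A (X w) = 0 :> R by apply: ind0 => /AV.
      rewrite phiw0 Aw0.
      by apply/andP; split; lra.
    have [Fw|nFw] := pselect (F (X w)); last first.
      by rewrite (ind1 _ (X @^-1` (V `\` F)))//; apply/andP; split; lra.
    rewrite (ind1 _ A) ?phi1//; last exact: FA.
    by apply/andP; split; lra.
  - lra.
have cv := cvg_in_distribution_Rintegral pT cK rX XsX cpsiphi bpsiphi.
have E0 : \int[P0]_w (psi (X w) - phi (X w)) <= e / 2.
  apply: err.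
  - exact: (continuous_random_measurable pT cK rX cpsiphi).
  - exact: (bounded_fun_comp X bpsiphi).
  - move=> w; have := phi01 (X w); have := psi01 (X w).
    have := ind01 _ (X @^-1` (V `\` F)) w; have := ind01 _ (~` (X @^-1` C)) w.
    move=> iC iVF psiw phiw.
    have [Cw|nCw] := pselect (C (X w)); last first.
      by rewrite (ind1 _ (~` (X @^-1` C)))//; lra.
    have [Vw|nVw] := pselect (V (X w)); last by rewrite psi0//; lra.
    have [Fw|nFw] := pselect (F (X w)); last first.
      by rewrite (ind1 _ (X @^-1` (V `\` F)))//; lra.
    by rewrite phi1//; lra.
(* The limit is at most [e / 2], and [3 * (e / 4)] leaves [e / 4] for the complement of [C]. *)
have : \forall k \near \oo, \int[P k]_w (psi (Xs k w) - phi (Xs k w)) < 3 * (e / 4).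
  by apply: (cvgr_lt _ cv); apply: le_lt_trans E0 _; lra.
apply: filterS => k Ek.
apply: (@le_trans _ _
  (\int[P k]_w ((psi (Xs k w) - phi (Xs k w)) + \1_(~` (Xs k @^-1` C)) w))).
  apply: le_bounded_Rintegral => //.
  - apply: measurableT_comp => //; apply: measurable_funB => //.
    exact: (@measurable_indic _ _ R setT (Xs k @^-1` U)
      (open_preimage_measurable pT cK (rXs k) oU)).
  - apply: bounded_fun_dist; last exact: bounded_fun_comp.
    exact: (bounded_fun_indic R (Xs k @^-1` U)).
  - apply: measurable_funD => //.
    exact: (continuous_random_measurable pT cK (rXs k) cpsiphi).
  - apply: bounded_funD; last exact: bounded_fun_indic.
    exact: (bounded_fun_comp (Xs k) bpsiphi).
  - move=> w; have := phi01 (Xs k w); have := psi01 (Xs k w).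
    have := ind01 _ (~` (Xs k @^-1` C)) w; rewrite ler_norml => iC psiw phiw.
    have [Uw|nUw] := pselect (U (Xs k w)); last first.
      by rewrite (ind0 _ U)// phi0//; apply/andP; split; lra.
    rewrite (ind1 _ U)//.
    have [Cw|nCw] := pselect (C (Xs k w)); last first.
      by rewrite (ind1 _ (~` (Xs k @^-1` C)))//; apply/andP; split; lra.
    by rewrite psi1//; apply/andP; split; lra.
rewrite RintegralD//; last 2 first.
- apply: integrable_bounded => //; last exact: (bounded_fun_comp (Xs k) bpsiphi).
  exact: (continuous_random_measurable pT cK (rXs k) cpsiphi).
- by apply: integrable_bounded => //; exact: bounded_fun_indic.
rewrite Rintegral_indic//; have := PC k; rewrite probability_EFin//; lra.
Qed.

End approximation.

(** * Approximation of monotone functions *)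

(** The sum counts the naturals below [y], so it is the ceiling of [y]. *)
Lemma layer_cake_approximation (R : realFieldType) (n : nat) (y : R) :
  0 <= y <= n%:R -> `|y - \sum_(i < n) (if (i%:R < y)%R then 1 else 0)| <= 1.
Proof.
elim: n y => [|n IH] y /andP[y0 yn].
  by rewrite big_ord0 subr0 ger0_norm// (le_trans yn).
rewrite big_ord_recr /=; have [ny|yn'] := ltP (n%:R : R) y; last first.
  by rewrite addr0; apply: IH; rewrite y0.
rewrite (eq_bigr (fun=> 1)); last first.
  move=> i _; have -> // : (i%:R < y) = true.
  by apply: lt_trans ny; rewrite ltr_nat.
rewrite sumr_const card_ord -natr1 in yn *.
by rewrite ler_norml; apply/andP; split; lra.
Qed.

(** Only finitely many membership patterns occur, and the points with a given pattern form a
    measurable set, written by De Morgan as the complement of a finite union. *)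
Lemma prod_measurable_step_fun (R : realType) (K : Type) (T : topologicalType)
    (n : nat) (U : 'I_n -> set (K -> T)) (g : {ffun 'I_n -> bool} -> R) :
  (forall i, prod_sigma (U i)) ->
  prod_measurable_fun (fun x => g [ffun i => x \in U i]).
Proof.
move=> mU B _.
rewrite (_ : _ @^-1` B = \bigcup_(b in [set b | B (g b)])
    ~` (\bigcup_(i in [set: 'I_n]) (if b i then ~` U i else U i))).
  apply: sigma_algebra_countable_bigcup => b _; apply: sigma_algebra_setC.
  apply: sigma_algebra_countable_bigcup => i _.
  by case: (b i); [exact: (sigma_algebra_setC (mU i))|exact: mU].
rewrite eqEsubset; split => x.
  move=> Bx; exists [ffun i => x \in U i] => // -[i _]; rewrite ffunE.
  by case: ifPn => [/set_mem|/negP nUx Ux]//; apply: nUx; exact: mem_set.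
move=> [b Bb nb]; rewrite /preimage/=.
have -> // : [ffun i => x \in U i] = b.
apply/ffunP => i; rewrite ffunE.
case bi : (b i).
  by rewrite mem_set//; apply: contrapT => nUx; apply: nb; exists i; rewrite // bi.
by rewrite memNset// => Ux; apply: nb; exists i; rewrite // bi.
Qed.

Lemma Rintegral_affine_sum_le (R : realType) (d : measure_display)
    (Omega : measurableType d) (P : probability Omega R) (n : nat)
    (h : 'I_n -> Omega -> R) (c t e : R) :
  0 <= t -> (forall i, measurable_fun setT (h i)) -> (forall i, bounded_fun (h i)) ->
  (forall i, \int[P]_w h i w <= e) ->
  \int[P]_w (c + t * \sum_(i < n) h i w) <= c + t * (n%:R * e).
Proof.
move=> t0 mh bh he.
have bsum (s : seq 'I_n) : bounded_fun (fun w => \sum_(i <- s) h i w).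
  elim: s => [|i s IH].
    by exists 0 => w; rewrite big_nil normr0.
  by under eq_fun do rewrite big_cons; exact: bounded_funD.
have msum (s : seq 'I_n) : measurable_fun setT (fun w => \sum_(i <- s) h i w).
  exact: measurable_sum.
have Isum (s : seq 'I_n) : \int[P]_w (\sum_(i <- s) h i w) <= (size s)%:R * e.
  elim: s => [|i s IH] /=.
    under eq_Rintegral do rewrite big_nil.
    by rewrite mul0r Rintegral_cst// mul0r.
  under eq_Rintegral do rewrite big_cons.
  rewrite RintegralD//; last 2 first.
  - exact: integrable_bounded.
  - exact: integrable_bounded.
  by rewrite -nat1r mulrDl mul1r lerD.
have Ic : \int[P]_(_ in setT) c = c.
  transitivity (c * fine (P setT)); first exact: Rintegral_cst.
  by rewrite probability_setT mulr1.
rewrite RintegralD//; last 2 first.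
- by apply: integrable_bounded => //; exists `|c|.
- apply: integrable_bounded; first exact: measurable_funM.
  exact: bounded_funZ.
rewrite Ic lerD2l RintegralZl//; last exact: integrable_bounded.
rewrite ler_wpM2l// (le_trans (Isum _))//.
by rewrite -sum1_size big_const_ord iter_addn_0 mul1n.
Qed.

Section admissible_approximation.
Context (R : realType) (T : completePseudoMetricType R) (le : T -> T -> Prop).
Context (K : Type) (d : nat -> measure_display) (Omega : forall k, measurableType (d k)).
Context (P : forall k, probability (Omega k) R) (Xs : forall k, Omega k -> K -> T).
Context (d0 : measure_display) (Omega0 : measurableType d0).
Context (P0 : probability Omega0 R) (X : Omega0 -> K -> T).
Arguments Xs : clear implicits.
Hypotheses (pT : polish T) (cle : closed_partial_order le) (cK : countable [set: K]).
Hypotheses (rXs : forall k, random_family (Xs k)) (rX : random_family X).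
Hypothesis XsX : cvg_in_distribution P Xs P0 X.

(** Up to [t], [f] is the staircase built on its level sets, which are upper events. Replacing their
    indicators by continuous functions gives [phi], and by indicators of open upper sets gives the
    monotone [f']. *)
Lemma admissible_approximation (f : (K -> T) -> R) (M e : R) :
  admissible le f -> 0 < M -> (forall x, `|f x| <= M) -> 0 < e ->
  exists (phi : {ptws K -> T} -> R) (f' : (K -> T) -> R),
  [/\ continuous phi, (forall x, `|phi x| <= M), admissible le f' &
    (forall x, `|f' x| <= M)] /\
  \int[P0]_w `|f (X w) - phi (X w)| <= e /\
  \forall k \near \oo, \int[P k]_w `|f' (Xs k w) - phi (Xs k w)| <= e.
Proof.
move=> [bf mf ndf] M0 fM e0.
have e4M0 : 0 < e / (4 * M) by rewrite divr_gt0// mulr_gt0.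
(* The [N] steps of height [t] cover the range from [-M] to [M]. This choice makes [t <= e / 2], and
   the [N] level errors [e / (4 * M)], weighted by [t], add up to [e / 2]. *)
have [n] := @ltr_add_invr R 0 _ e4M0; rewrite add0r => nlt.
pose N := n.+1; pose t : R := 2 * M / N%:R.
have N0 : 0 < N%:R :> R by rewrite ltr0n.
have t0 : 0 < t by rewrite divr_gt0// mulr_gt0.
have tN : t * N%:R = 2 * M by rewrite /t divfK// gt_eqF.
have te : t <= e / 2.
  have -> : e / 2 = 2 * M * (e / (4 * M)) by field; rewrite gt_eqF.
  by rewrite /t ler_pM2l ?mulr_gt0// ltW.
pose A (i : 'I_N) : set (K -> T) := f @^-1` `]i%:R * t - M, +oo[%classic.
have mA i : prod_sigma (A i) by apply: mf; exact: measurable_itv.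
have uA i : upper_event le (A i).
  move=> x y; rewrite /A /preimage/= !in_itv/= !andbT => fx xy.
  by apply: lt_le_trans fx _; exact: ndf.
have /choice[Uphi UphiP] i : exists Uphi : set {ptws K -> T} * ({ptws K -> T} -> R),
  [/\ open Uphi.1, upper_event le Uphi.1, continuous Uphi.2 &
     (forall x, 0 <= Uphi.2 x <= 1)] /\
  \int[P0]_w `|\1_(A i) (X w) - Uphi.2 (X w)| <= e / (4 * M) /\
  \forall k \near \oo, \int[P k]_w `|\1_(Uphi.1) (Xs k w) - Uphi.2 (Xs k w)| <= e / (4 * M).
  have [U [phi UphiP]] :=
    upper_event_approximation pT cle cK rXs rX XsX (mA i) (@uA i) e4M0.
  by exists (U, phi).
pose U i := (Uphi i).1; pose phi i := (Uphi i).2.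
pose step (b : 'I_N -> R) : R := - M + t * \sum_(i < N) b i.
have step_bound b : (forall i, 0 <= b i <= 1) -> `|step b| <= M.
  move=> b01; have s0 : 0 <= \sum_(i < N) b i.
    by apply: sumr_ge0 => i _; have /andP[] := b01 i.
  have s1 : \sum_(i < N) b i <= N%:R.
    rewrite -[N in leRHS]card_ord -sumr_const; apply: ler_sum => i _.
    by have /andP[] := b01 i.
  have := ler_wpM2l (ltW t0) s1; rewrite tN => ts.
  have := mulr_ge0 (ltW t0) s0 => ts0.
  by rewrite /step ler_norml; apply/andP; split; lra.
have step_dist b b' : `|step b - step b'| <= t * \sum_(i < N) `|b i - b' i|.
  rewrite /step opprD addrACA subrr add0r -mulrBr -sumrB normrM gtr0_norm//.
  by rewrite ler_pM2l// ler_norm_sum.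
have ind01 V (B : set V) x : 0 <= (\1_B x : R) <= 1.
  by rewrite indicE; case: (_ \in _); rewrite lexx ler01.
(* Rescaling the range of [f] to the interval from 0 to [N] turns the level sets into the integer
   thresholds of the layer-cake sum. *)
have f_step x : `|f x - step (fun i => \1_(A i) x)| <= t.
  pose y := (f x + M) / t.
  have yt : y * t = f x + M by rewrite /y divfK// gt_eqF.
  have y0N : 0 <= y <= N%:R.
    have := fM x; rewrite ler_norml => /andP[f1 f2]; apply/andP; split.
      by rewrite divr_ge0 ?(ltW t0)//; lra.
    by rewrite ler_pdivrMr// mulrC tN; lra.
  have -> : f x - step (fun i => \1_(A i) x) =
      t * (y - \sum_(i < N) (if (i%:R < y)%R then 1 else 0)).
    rewrite mulrBr mulrC yt /step opprD opprK addrA; congr (_ - t * _).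
    apply: eq_bigr => i _; have -> : (i%:R < y) = (i%:R * t - M < f x).
      by rewrite ltrBlDr -yt ltr_pM2r.
    rewrite indicE; case: ifPn => [fi|/negP fi].
      by rewrite mem_set// /A /preimage/= in_itv/= fi.
    by rewrite memNset// /A /preimage/= in_itv/= andbT.
  rewrite normrM gtr0_norm// -[leRHS]mulr1 ler_pM2l//.
  exact: layer_cake_approximation.
exists (fun x => step (fun i => phi i x)), (fun x => step (fun i => \1_(U i) x)).
have ndstep x y : (forall k, le (x k) (y k)) ->
    step (fun i => \1_(U i) x) <= step (fun i => \1_(U i) y).
  move=> xy; rewrite /step lerD2l ler_pM2l//; apply: ler_sum => i _.
  rewrite !indicE; have [[_ uU _ _] _] := UphiP i.
  have [/set_mem Ux|_] := boolP (x \in U i); last by rewrite ler0n.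
  by rewrite (mem_set (uU _ _ Ux xy)).
have oU i : open (U i) by have [[]] := UphiP i.
have cphi i : continuous (phi i) by have [[]] := UphiP i.
have phi01 i x : 0 <= phi i x <= 1 by have [[_ _ _ h01] _] := UphiP i; exact: h01.
have cstep : continuous (fun x : {ptws K -> T} => step (fun i => phi i x)).
  have csum : continuous (fun y : {ptws K -> T} => \sum_(i < N) (phi i y : R^o)).
    by apply: continuous_big => [|i _]; [exact: add_continuous|exact: cphi].
  move=> x; rewrite /step; apply: (@continuousD R R^o _ (cst (- M))
    (fun y => t * \sum_(i < N) (phi i y : R^o))).
    exact: cst_continuous.
  by apply: continuousM; [exact: cst_continuous|exact: csum].
have mstep : prod_measurable_fun (fun x => step (fun i => \1_(U i) x)).
  have mU i : prod_sigma (U i : set (K -> T)) by exact: (open_prod_sigma pT cK (oU i)).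
  have := prod_measurable_step_fun
    (fun b : {ffun 'I_N -> bool} => - M + t * \sum_(i < N) (b i)%:R) mU.
  rewrite (_ : (fun x => _) = (fun x => step (fun i => \1_(U i) x)))//.
  apply/funext => x; rewrite /step; congr (_ + _ * _).
  by apply: eq_bigr => i _; rewrite ffunE indicE.
have bstep : bounded_fun (fun x : K -> T => step (fun i => \1_(U i) x)).
  by exists M => x; apply: step_bound => i; exact: ind01.
have bphi : bounded_fun (fun x : {ptws K -> T} => step (fun i => phi i x)).
  by exists M => x; apply: step_bound => i; exact: phi01.
have bphii i : bounded_fun (phi i).
  by exists 1 => x; have /andP[? ?] := phi01 i x; rewrite ger0_norm.
split; first split.
- exact: cstep.
- by move=> x; apply: step_bound => i; exact: phi01.
- by split.
- by move=> x; apply: step_bound => i; exact: ind01.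
have eN : t * (N%:R * (e / (4 * M))) = e / 2.
  by rewrite mulrA tN; field; rewrite gt_eqF.
(* Used twice: with [c = t] for [f] under [P0], and with [c = 0] for [f'] under [P k], since [f'] is
   itself a staircase. *)
have approx (d' : measure_display) (Omega' : measurableType d')
    (Q : probability Omega' R) (Y : Omega' -> K -> T) (B : 'I_N -> set (K -> T))
    (h : (K -> T) -> R) (c : R) :
    random_family Y -> (forall i, prod_sigma (B i)) ->
    prod_measurable_fun h -> bounded_fun h ->
    (forall x, `|h x - step (fun i => \1_(B i) x)| <= c) ->
    (forall i, \int[Q]_w `|\1_(B i) (Y w) - phi i (Y w)| <= e / (4 * M)) ->
    \int[Q]_w `|h (Y w) - step (fun i => phi i (Y w))| <= c + e / 2.
  move=> rY mB mh bh hc IB.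
  have mBphi i : measurable_fun setT (fun w => `|\1_(B i) (Y w) - phi i (Y w)|).
    apply: measurableT_comp => //; apply: measurable_funB.
      exact: (@measurable_indic _ _ R setT (Y @^-1` B i)
        (random_family_measurable rY (mB i))).
    exact: (continuous_random_measurable pT cK rY (cphi i)).
  have bBphi i : bounded_fun (fun w => `|\1_(B i) (Y w) - phi i (Y w)|).
    apply: bounded_fun_dist; last exact: bounded_fun_comp.
    exact: (bounded_fun_indic R (Y @^-1` B i)).
  have := Rintegral_affine_sum_le c (ltW t0) mBphi bBphi IB.
  rewrite eN; apply: le_trans.
  apply: le_bounded_Rintegral.
  - apply: measurableT_comp => //; apply: measurable_funB.
      exact: (prod_measurable_fun_comp rY mh).
    exact: (continuous_random_measurable pT cK rY cstep).
  - apply: bounded_fun_dist; first exact: bounded_fun_comp.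
    exact: (bounded_fun_comp Y bphi).
  - by apply: measurable_funD => //; apply: measurable_funM => //; exact: measurable_sum.
  - apply: bounded_funD; first by exists `|c|.
    apply: bounded_funZ; exists N%:R => w; rewrite ger0_norm; last exact: sumr_ge0.
    rewrite -[N in leRHS]card_ord -sumr_const; apply: ler_sum => i _.
    have := ind01 _ (B i) (Y w); have := phi01 i (Y w).
    by rewrite ler_norml => pw iw; apply/andP; split; lra.
  - move=> w.
    have := step_dist (fun i => \1_(B i) (Y w)) (fun i => phi i (Y w)).
    have := hc (Y w); have := ler_distD (step (fun i => \1_(B i) (Y w)))
      (h (Y w)) (step (fun i => phi i (Y w))).
    by lra.
split.
  have : t + e / 2 <= e by lra.
  apply: le_trans; apply: approx => //.
  by move=> i; have [_ []] := UphiP i.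
have : \forall k \near \oo, forall i,
    \int[P k]_w `|\1_(U i) (Xs k w) - phi i (Xs k w)| <= e / (4 * M).
  by apply: filter_forall => i; have [_ []] := UphiP i.
apply: filterS => k Ek.
have e2 : 0 + e / 2 <= e by lra.
apply: le_trans e2.
apply: (approx _ _ (P k) (Xs k) U (fun x => step (fun i => \1_(U i) x)) 0
  (rXs k) _ mstep bstep _ Ek).
- by move=> i; exact: (open_prod_sigma pT cK (oU i)).
- by move=> x; rewrite subrr normr0.
Qed.
End admissible_approximation.

(** * Covariances *)

Lemma bounded_fun_pos_bound (R : realType) (U : Type) (f : U -> R) :
  bounded_fun f -> exists2 M : R, 0 < M & forall x, `|f x| <= M.
Proof.
move=> [M fM]; exists (`|M| + 1) => [|x]; first by rewrite ltr_pwDr.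
by rewrite (le_trans (fM x))// ler_wpDr// ler_norm.
Qed.

Section covariance.
Context (R : realType).

Definition bounded_covariance (d : measure_display) (Omega : measurableType d)
  (P : probability Omega R) (f g : Omega -> R) : R :=
  \int[P]_w (f w * g w) - \int[P]_w f w * \int[P]_w g w.

Lemma Rintegral_dist_le (d : measure_display) (Omega : measurableType d)
    (P : probability Omega R) (f g : Omega -> R) :
  measurable_fun setT f -> bounded_fun f -> measurable_fun setT g -> bounded_fun g ->
  `|\int[P]_w f w - \int[P]_w g w| <= \int[P]_w `|f w - g w|.
Proof.
move=> mf bf mg bg; rewrite -RintegralB//; last 2 first.
- exact: integrable_bounded.
- exact: integrable_bounded.
apply: le_normr_Rintegral => //; apply: integrable_bounded.
  exact: measurable_funB.
apply: bounded_funD => //; case: bg => M gM; exists M => x; by rewrite normrN.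
Qed.

Lemma Rintegral_norm_le (d : measure_display) (Omega : measurableType d)
    (P : probability Omega R) (f : Omega -> R) (M : R) :
  measurable_fun setT f -> (forall w, `|f w| <= M) -> `|\int[P]_w f w| <= M.
Proof.
move=> mf fM; have bf : bounded_fun f by exists M.
apply: (@le_trans _ _ (\int[P]_w `|f w|)).
  by apply: le_normr_Rintegral => //; exact: integrable_bounded.
apply: (@le_trans _ _ (\int[P]_(w in setT) M)).
  apply: le_bounded_Rintegral => //.
  - exact: measurableT_comp.
  - by exists M => w; rewrite normr_id.
  - by exists `|M|.
have -> // : \int[P]_(w in setT) M = M.
transitivity (M * fine (P setT)); first exact: Rintegral_cst.
by rewrite probability_setT mulr1.
Qed.

(** The mean of the product and the product of the means each move by at most [(M + N) * e], by
    writing [f * g - f' * g'] as [g * (f - f') + f' * (g - g')]. *)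
Lemma bounded_covariance_dist (d : measure_display) (Omega : measurableType d)
    (P : probability Omega R) (f f' g g' : Omega -> R) (M N e : R) :
  measurable_fun setT f -> measurable_fun setT f' ->
  measurable_fun setT g -> measurable_fun setT g' ->
  (forall w, `|f w| <= M) -> (forall w, `|f' w| <= M) ->
  (forall w, `|g w| <= N) -> (forall w, `|g' w| <= N) ->
  \int[P]_w `|f w - f' w| <= e -> \int[P]_w `|g w - g' w| <= e ->
  `|bounded_covariance P f g - bounded_covariance P f' g'| <= 2 * (M + N) * e.
Proof.
move=> mf mf' mg mg' fM f'M gN g'N ffe gge.
have bf : bounded_fun f by exists M.
have bf' : bounded_fun f' by exists M.
have bg : bounded_fun g by exists N.
have bg' : bounded_fun g' by exists N.
have M0 : 0 <= M by exact: le_trans (fM point).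
have N0 : 0 <= N by exact: le_trans (gN point).
have mff : measurable_fun setT (fun w => `|f w - f' w|).
  by apply: measurableT_comp => //; exact: measurable_funB.
have mgg : measurable_fun setT (fun w => `|g w - g' w|).
  by apply: measurableT_comp => //; exact: measurable_funB.
have bff := bounded_fun_dist bf bf'.
have bgg := bounded_fun_dist bg bg'.
have prod : `|\int[P]_w (f w * g w) - \int[P]_w (f' w * g' w)| <= (M + N) * e.
  apply: (le_trans (Rintegral_dist_le _ _ _ _ _)).
  - exact: measurable_funM.
  - exact: bounded_funM.
  - exact: measurable_funM.
  - exact: bounded_funM.
  apply: (@le_trans _ _
    (\int[P]_w (N * `|f w - f' w| + M * `|g w - g' w|))).
    apply: le_bounded_Rintegral.
    - by apply: measurableT_comp => //; apply: measurable_funB; exact: measurable_funM.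
    - by apply: bounded_fun_dist; exact: bounded_funM.
    - by apply: measurable_funD; exact: measurable_funM.
    - by apply: bounded_funD; exact: bounded_funZ.
    move=> w; have -> : f w * g w - f' w * g' w =
      g w * (f w - f' w) + f' w * (g w - g' w) by ring.
    by rewrite (le_trans (ler_normD _ _))// !normrM lerD// ler_wpM2r.
  rewrite RintegralD//; last 2 first.
  - by apply: integrable_bounded; [exact: measurable_funM|exact: bounded_funZ].
  - by apply: integrable_bounded; [exact: measurable_funM|exact: bounded_funZ].
  rewrite !RintegralZl//; [|exact: integrable_bounded|exact: integrable_bounded].
  by rewrite mulrDl addrC lerD// ler_wpM2l.
have single : `|\int[P]_w f w * \int[P]_w g w - \int[P]_w f' w * \int[P]_w g' w|
    <= (M + N) * e.
  have -> : \int[P]_w f w * \int[P]_w g w - \int[P]_w f' w * \int[P]_w g' w =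
    \int[P]_w g w * (\int[P]_w f w - \int[P]_w f' w) +
    \int[P]_w f' w * (\int[P]_w g w - \int[P]_w g' w) by ring.
  rewrite (le_trans (ler_normD _ _))// !normrM mulrDl addrC.
  apply: lerD; apply: ler_pM => //.
  - exact: Rintegral_norm_le.
  - exact: le_trans (Rintegral_dist_le _ mg bg mg' bg') gge.
  - exact: Rintegral_norm_le.
  - exact: le_trans (Rintegral_dist_le _ mf bf mf' bf') ffe.
have := prod; have := single; rewrite /bounded_covariance !ler_norml.
by move=> /andP[? ?] /andP[? ?]; apply/andP; split; lra.
Qed.

(** * Transfer of covariances from the limit to the sequence *)

Context (T : completePseudoMetricType R) (le : T -> T -> Prop).
Context (I : Type) (d : nat -> measure_display) (Omega : forall k, measurableType (d k)).
Context (P : forall k, probability (Omega k) R) (Xs : forall k, Omega k -> I -> T).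
Context (d0 : measure_display) (Omega0 : measurableType d0).
Context (P0 : probability Omega0 R) (X : Omega0 -> I -> T).
Arguments Xs : clear implicits.
Hypotheses (pT : polish T) (cle : closed_partial_order le) (cI : countable [set: I]).
Hypotheses (rXs : forall k, random_family (Xs k)) (rX : random_family X).
Hypothesis XsX : cvg_in_distribution P Xs P0 X.

Lemma cvg_in_distribution_restr (J : set I) :
  cvg_in_distribution P (fun k w => @restr I T J (Xs k w)) P0
    (fun w => @restr I T J (X w)).
Proof.
move=> h ch bh.
have chJ : continuous (fun x : {ptws I -> T} => h (@restr I T J x)).
  exact: continuous_comp_restr.
exact: (XsX chJ (bounded_fun_comp _ bh)).
Qed.

(** Three errors of [e / 3]: from [f], [g] to continuous functions under [P0], from [P0] to [P k] by
    weak convergence, and from the continuous functions to [f'], [g'] under [P k]. Two independent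
    index sets serve both kinds of association: [J'] is the complement of [J] or [J] itself. *)
Lemma covariance_approximation (J J' : set I)
    (f : ({i : I | J i} -> T) -> R) (g : ({i : I | J' i} -> T) -> R) (e : R) :
  admissible le f -> admissible le g -> 0 < e ->
  exists (f' : ({i : I | J i} -> T) -> R) (g' : ({i : I | J' i} -> T) -> R),
    [/\ admissible le f', admissible le g' &
    exists k, `|bounded_covariance (P k) (fun w => f' (restr (Xs k w)))
                  (fun w => g' (restr (Xs k w))) -
                bounded_covariance P0 (fun w => f (restr (X w)))
                  (fun w => g (restr (X w)))| <= e].
Proof.
move=> af ag e0.
have [bf mf ndf] := af; have [bg mg ndg] := ag.
have [M M0 fM] := bounded_fun_pos_bound bf.
have [N N0 gN] := bounded_fun_pos_bound bg.
(* Chosen so that the covariance bound [2 * (M + N) * del] equals [e / 3]. *)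
pose del := e / (6 * (M + N)).
have MN0 : 0 < 6 * (M + N) by rewrite mulr_gt0// addr_gt0.
have del0 : 0 < del by rewrite divr_gt0.
have delE : 2 * (M + N) * del = e / 3.
  by rewrite /del; field; rewrite gt_eqF//; lra.
have rXJ J1 : random_family (fun w => @restr I T J1 (X w)) := random_family_restr (J := J1) rX.
have rXsJ J1 k : random_family (fun w => @restr I T J1 (Xs k w)) :=
  random_family_restr (J := J1) (rXs k).
have [phi [f' [[cphi phiM af' f'M] [fphi f'phi]]]] := admissible_approximation
  pT cle (@countable_sig I J cI) (rXsJ J) (rXJ J) (@cvg_in_distribution_restr J)
  af M0 fM del0.
have [psi [g' [[cpsi psiN ag' g'N] [gpsi g'psi]]]] := admissible_approximation
  pT cle (@countable_sig I J' cI) (rXsJ J') (rXJ J') (@cvg_in_distribution_restr J')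
  ag N0 gN del0.
have [_ mf' _] := af'; have [_ mg' _] := ag'.
have cphiJ : continuous (fun x : {ptws I -> T} => phi (@restr I T J x)).
  exact: continuous_comp_restr.
have cpsiJ : continuous (fun x : {ptws I -> T} => psi (@restr I T J' x)).
  exact: continuous_comp_restr.
have cpp : continuous (fun x : {ptws I -> T} => phi (@restr I T J x) * psi (@restr I T J' x)).
  by move=> x; apply: continuousM; [exact: cphiJ|exact: cpsiJ].
have bphiJ : bounded_fun (fun x : {ptws I -> T} => phi (@restr I T J x)) by exists M.
have bpsiJ : bounded_fun (fun x : {ptws I -> T} => psi (@restr I T J' x)) by exists N.
have bpp := bounded_funM bphiJ bpsiJ.
(* As functions on the full product, [phi], [psi] and their product are continuous and bounded, so
   all three means converge. *)
have cv : (fun k => bounded_covariance (P k) (fun w => phi (@restr I T J (Xs k w)))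
    (fun w => psi (@restr I T J' (Xs k w)))) @ \oo -->
    bounded_covariance P0 (fun w => phi (@restr I T J (X w)))
    (fun w => psi (@restr I T J' (X w))).
  apply: cvgB; last apply: cvgM.
  - exact: (cvg_in_distribution_Rintegral pT cI rX XsX cpp bpp).
  - exact: (cvg_in_distribution_Rintegral pT cI rX XsX cphiJ bphiJ).
  - exact: (cvg_in_distribution_Rintegral pT cI rX XsX cpsiJ bpsiJ).
exists f', g'; split=> //.
have e30 : 0 < e / 3 by rewrite divr_gt0.
have /cvgrPdist_le/(_ _ e30) near_cov := cv.
have [k [[]]] := filter_ex (filterI (filterI f'phi g'psi) near_cov).
move=> f'phik g'psik covk; exists k.
have A1 := bounded_covariance_dist
  (prod_measurable_fun_comp (rXsJ J k) mf')
  (continuous_random_measurable pT cI (rXs k) cphiJ)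
  (prod_measurable_fun_comp (rXsJ J' k) mg')
  (continuous_random_measurable pT cI (rXs k) cpsiJ)
  (fun w => f'M _) (fun w => phiM _) (fun w => g'N _) (fun w => psiN _) f'phik g'psik.
have A2 := bounded_covariance_dist
  (prod_measurable_fun_comp (rXJ J) mf)
  (continuous_random_measurable pT cI rX cphiJ)
  (prod_measurable_fun_comp (rXJ J') mg)
  (continuous_random_measurable pT cI rX cpsiJ)
  (fun w => fM _) (fun w => phiM _) (fun w => gN _) (fun w => psiN _) fphi gpsi.
move: A1 A2 covk; rewrite delE !ler_norml.
move=> /andP[? ?] /andP[? ?] /andP[? ?]; apply/andP; split; lra.
Qed.

(** Links the extended-real integrals in the definition of association to real-valued
    covariances. *)
Lemma integral_restr_EFin (d' : measure_display) (Omega' : measurableType d')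
    (Q : probability Omega' R) (Y : Omega' -> I -> T) (J : set I)
    (f : ({i : I | J i} -> T) -> R) :
  random_family Y -> admissible le f ->
  (\int[Q]_w (f (restr (Y w)))%:E)%E = (\int[Q]_w f (restr (Y w)))%:E.
Proof.
move=> rY [bf mf _]; apply: integral_EFin_Rintegral; last exact: bounded_fun_comp.
exact: (prod_measurable_fun_comp (random_family_restr (J := J) rY) mf).
Qed.

Lemma integral_restrM_EFin (d' : measure_display) (Omega' : measurableType d')
    (Q : probability Omega' R) (Y : Omega' -> I -> T) (J J' : set I)
    (f : ({i : I | J i} -> T) -> R) (g : ({i : I | J' i} -> T) -> R) :
  random_family Y -> admissible le f -> admissible le g ->
  (\int[Q]_w (f (restr (Y w)) * g (restr (Y w)))%:E)%E =
  (\int[Q]_w (f (restr (Y w)) * g (restr (Y w))))%:E.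
Proof.
move=> rY [bf mf _] [bg mg _]; apply: integral_EFin_Rintegral.
  apply: measurable_funM.
    exact: (prod_measurable_fun_comp (random_family_restr (J := J) rY) mf).
  exact: (prod_measurable_fun_comp (random_family_restr (J := J') rY) mg).
by apply: bounded_funM; exact: bounded_fun_comp.
Qed.

End covariance.

(** * Association of the limit family *)

Theorem theorem3p6 (R : realType) (T : completePseudoMetricType R)
  (le : T -> T -> Prop) (I : Type)
  (d : nat -> measure_display) (Omega : forall k, measurableType (d k))
  (P : forall k, probability (Omega k) R) (Xs : forall k, Omega k -> I -> T)
  (d0 : measure_display) (Omega0 : measurableType d0) (P0 : probability Omega0 R)
  (X : Omega0 -> I -> T) :
  polish T -> closed_partial_order le -> countable [set: I] ->
  (forall k, random_family (Xs k)) -> random_family X ->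
  cvg_in_distribution P Xs P0 X ->
  ((forall k, negatively_associated (P k) le (Xs k)) ->
     negatively_associated P0 le X) /\
  ((forall k, positively_associated (P k) le (Xs k)) ->
     positively_associated P0 le X).
Proof.
move=> pT cle cI rXs rX XsX; split=> assoc J f g af ag.
- rewrite (integral_restrM_EFin _ rX af ag) (integral_restr_EFin _ rX af)
    (integral_restr_EFin _ rX ag) -EFinM lee_fin -subr_le0.
  change (bounded_covariance P0 (fun w => f (restr (X w)))
    (fun w => g (restr (X w))) <= 0).
  (* It suffices to bound the covariance by every [e > 0]: it is within [e] of a covariance under
     some [P k], which is nonpositive by association. *)
  apply/ler_addgt0Pr => e e0; rewrite add0r.
  have [f' [g' [af' ag' [k]]]] :=
    covariance_approximation pT cle cI rXs rX XsX af ag e0.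
  have covk : bounded_covariance (P k) (fun w => f' (restr (Xs k w)))
      (fun w => g' (restr (Xs k w))) <= 0.
    rewrite subr_le0 -lee_fin EFinM -(integral_restrM_EFin _ (rXs k) af' ag').
    rewrite -(integral_restr_EFin _ (rXs k) af') -(integral_restr_EFin _ (rXs k) ag').
    exact: assoc.
  by rewrite ler_norml => /andP[? ?]; lra.
- rewrite (integral_restrM_EFin _ rX af ag) (integral_restr_EFin _ rX af)
    (integral_restr_EFin _ rX ag) -EFinM lee_fin -subr_ge0.
  change (0 <= bounded_covariance P0 (fun w => f (restr (X w)))
    (fun w => g (restr (X w)))).
  (* The same argument with the opposite sign. *)
  apply/ler_addgt0Pr => e e0.
  have [f' [g' [af' ag' [k]]]] :=
    covariance_approximation pT cle cI rXs rX XsX af ag e0.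
  have covk : 0 <= bounded_covariance (P k) (fun w => f' (restr (Xs k w)))
      (fun w => g' (restr (Xs k w))).
    rewrite subr_ge0 -lee_fin EFinM -(integral_restrM_EFin _ (rXs k) af' ag').
    rewrite -(integral_restr_EFin _ (rXs k) af') -(integral_restr_EFin _ (rXs k) ag').
    exact: assoc.
  by rewrite ler_norml => /andP[? ?]; lra.
Qed.
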